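(* Let $\Lambda$ be a right $2$-Nakayama artin algebra and let $M$ be an indecomposable non-projective right $\Lambda$-module. (a) If $M\cong P/\mathrm{rad}^t(P)$ for some $1\le t<\ell\ell(P)$, where $P$ is a uniserial projective right $\Lambda$-module, then the sequence $$0\longrightarrow \frac{\mathrm{rad}(P)}{\mathrm{rad}^{t+1}(P)}\xrightarrow{\begin{bmatrix} q\\ i\end{bmatrix}} \frac{\mathrm{rad}(P)}{\mathrm{rad}^{t}(P)}\oplus\frac{P}{\mathrm{rad}^{t+1}(P)}\xrightarrow{[-j,\;p]}\frac{P}{\mathrm{rad}^t(P)}\longrightarrow 0$$ is an almost split sequence, where $p$ and $q$ are the canonical epimorphisms and $i$ and $j$ are the inclusion homomorphisms. (b) If $M\cong P/S_t$ for some $1\le t\le 2$, where $P$ is an indecomposable $2$-factor serial projective right $\Lambda$-module with $\mathrm{rad}(P)=\mathrm{soc}(P)=S_1\oplus S_2$ ($S_1,S_2$ simple submodules of $P$), then the sequence $$0\longrightarrow S_t\xrightarrow{i_1}P\xrightarrow{p_1}\frac{P}{S_t}\longrightarrow 0$$ is an almost split sequence, where $i_1$ is the inclusion and $p_1$ is the canonical epimorphism. (c) If $M\cong P/\mathrm{rad}(P)$, where $P$ is an indecomposable $2$-factor serial projective right $\Lambda$-module with $\mathrm{rad}(P)=\mathrm{soc}(P)=S_1\oplus S_2$ ($S_1,S_2$ simple submodules of $P$), then the sequence $$0\longrightarrow P\xrightarrow{\begin{bmatrix}\pi_1\\ \pi_2\end{bmatrix}}\frac{P}{S_1}\oplus\frac{P}{S_2}\xrightarrow{[-\pi_3,\;\pi_4]}\frac{P}{\mathrm{rad}(P)}\longrightarrow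 0$$ is an almost split sequence, where $\pi_1,\pi_2,\pi_3,\pi_4$ are the canonical epimorphisms.
   Context: An artin algebra is an algebra $\Lambda$ over a commutative artinian ring $R$ that is finitely generated as an $R$-module. All modules are finitely generated right $\Lambda$-modules; $\ell\ell(M)$ denotes the Loewy length of $M$. For a module $M$ put $\mathrm{rad}^0(M)=M$, $\mathrm{rad}^{i+1}(M)=\mathrm{rad}(\mathrm{rad}^i(M))$. A module is uniserial if it has a unique composition series (the zero module counts as uniserial). Let $M$ be a nonzero module of length $l$. $M$ is $1$-factor serial if it is uniserial; for $l\ge 2$, $M$ is $2$-factor serial if $M/\mathrm{rad}^{l-2}(M)$ is uniserial and $M/\mathrm{rad}^{l-1}(M)$ is not uniserial. $\Lambda$ is right $2$-Nakayama if every indecomposable right $\Lambda$-module is $1$-factor serial or $2$-factor serial and there exists at least one indecomposable $2$-factor serial right $\Lambda$-module. *)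

(* Defs.v *)
From HB Require Import structures.
From mathcomp Require Import all_boot all_algebra.
From mathcomp Require Import boolp.

Set Implicit Arguments.
Unset Strict Implicit.
Unset Printing Implicit Defensive.

Import GRing.Theory.
Local Open Scope ring_scope.
Local Open Scope quotient_scope.

(* Modules below are left modules over an arbitrary ring A; right modules over
   an algebra L are obtained with A := L^c, the converse ring.
   A submodule of M is a bundled predicate U : submodClosed M; submodules are
   compared extensionally, by {subset U <= V} and U =i V.  Predicates with
   undecidable membership are turned into boolean ones with asbool. *)

Section Submodules.
Variables (A : pzRingType) (M : lmodType A).
Implicit Types U V W S : submodClosed M.

Definition zero_pred : {pred M} := fun x => x == 0.

Lemma zero_submod_closed : subsemimod_closed zero_pred.
Proof.
split=> [|a x /eqP->]; last by apply/eqP; rewrite scaler0.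
by split=> [|x y /eqP-> /eqP->]; apply/eqP; rewrite ?addr0.
Qed.
HB.instance Definition _ :=
  GRing.isSubmodClosed.Build A M zero_pred zero_submod_closed.
Definition zero_submod : submodClosed M := zero_pred.

Definition full_pred : {pred M} := fun=> true.

Lemma full_submod_closed : subsemimod_closed full_pred.
Proof. by []. Qed.
HB.instance Definition _ :=
  GRing.isSubmodClosed.Build A M full_pred full_submod_closed.
Definition full_submod : submodClosed M := full_pred.

Definition maximal_submod U V : Prop :=
  [/\ {subset V <= U}, ~ {subset U <= V} &
      forall W, {subset V <= W} -> {subset W <= U} ->
        W =i V \/ W =i U].

(* The intersection of all maximal submodules of U (and U if there is none). *)
Definition rad_pred U : {pred M} :=
  fun x => `[< x \in U /\ forall V, maximal_submod U V -> x \in V >].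

Lemma rad_submod_closed U : subsemimod_closed (rad_pred U).
Proof.
split=> [|a x /asboolP[xU xV]]; last first.
  by apply/asboolP; split=> [|V mV]; apply: rpredZ => //; exact: xV.
split=> [|x y /asboolP[xU xV] /asboolP[yU yV]]; apply/asboolP.
  by split=> [|V _]; exact: rpred0.
by split=> [|V mV]; apply: rpredD => //; [exact: xV|exact: yV].
Qed.
HB.instance Definition _ U :=
  GRing.isSubmodClosed.Build A M (rad_pred U) (rad_submod_closed U).
Definition rad_submod U : submodClosed M := rad_pred U.

Lemma rad_submod_sub U : {subset rad_submod U <= U}.
Proof. by move=> x /asboolP[]. Qed.

Definition simple_submod S : Prop :=
  ~ S =i zero_submod /\
  forall W, {subset W <= S} -> W =i zero_submod \/ W =i S.

(* The sum of all simple submodules of M. *)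
Definition soc_pred : {pred M} := fun x =>
  `[< exists2 s : seq M, x = \sum_(y <- s) y &
      forall y, y \in s -> exists2 S, simple_submod S & y \in S >].

Lemma soc_submod_closed : subsemimod_closed soc_pred.
Proof.
split=> [|a x /asboolP[s -> sS]]; last first.
  apply/asboolP; exists (map ( *:%R a) s); first by rewrite scaler_sumr big_map.
  by move=> _ /mapP[y /sS[S simS yS] ->]; exists S; rewrite ?rpredZ.
split=> [|x y /asboolP[s -> sS] /asboolP[s' -> sS']]; apply/asboolP.
  by exists [::]; rewrite ?big_nil.
exists (s ++ s'); first by rewrite big_cat.
by move=> z; rewrite mem_cat => /orP[/sS|/sS'].
Qed.
HB.instance Definition _ :=
  GRing.isSubmodClosed.Build A M soc_pred soc_submod_closed.
Definition soc : submodClosed M := soc_pred.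

(* W is the internal direct sum of U and V. *)
Definition internal_dsum W U V : Prop :=
  [/\ {subset U <= W}, {subset V <= W},
      forall x, x \in W -> exists u v, [/\ u \in U, v \in V & x = u + v] &
      forall x, x \in U -> x \in V -> x = 0].

Lemma internal_dsum_subl W U V : internal_dsum W U V -> {subset U <= W}.
Proof. by case. Qed.

Lemma internal_dsum_subr W U V : internal_dsum W U V -> {subset V <= W}.
Proof. by case. Qed.

Definition submod_type U : Type := {x : M | x \in U}.
HB.instance Definition _ U := SubChoice.on (submod_type U).
HB.instance Definition _ U := [SubChoice_isSubLmodule of submod_type U by <:].

Definition submod_val U : submod_type U -> M := val.
HB.instance Definition _ U := GRing.Linear.on (@submod_val U).

(* The submodule U :&: V, seen as a submodule of the module U. *)
Definition submod_in_pred U V : {pred submod_type U} :=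
  fun x => val x \in V.
Arguments submod_in_pred : clear implicits.

Lemma submod_in_closed U V : subsemimod_closed (submod_in_pred U V).
Proof.
have inV x : (x \in submod_in_pred U V) = (val x \in V) by [].
split=> [|a x xV]; last by rewrite inV linearZ rpredZ -?inV.
by split=> [|x y xV yV]; rewrite inV ?raddf0 ?rpred0 // raddfD rpredD -?inV.
Qed.
HB.instance Definition _ U V := GRing.isSubmodClosed.Build A (submod_type U)
  (submod_in_pred U V) (submod_in_closed U V).
Definition submod_in U V : submodClosed (submod_type U) := submod_in_pred U V.

Lemma submod_in_mono U V W :
  {subset V <= W} -> {subset submod_in U V <= submod_in U W}.
Proof. by move=> VW x; apply: VW. Qed.

Definition submod_pred U : {pred M} := fun x => x \in U.

Lemma submod_zmod_closed U : zmod_closed (submod_pred U).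
Proof.
split=> [|x y xU yU]; first exact: (rpred0 U).
by apply: (rpredD (S := U)) => //; rewrite -scaleN1r; apply: rpredZ.
Qed.
HB.instance Definition _ U :=
  GRing.isZmodClosed.Build M (submod_pred U) (submod_zmod_closed U).
Definition submod_zmod U : zmodClosed M := submod_pred U.

Definition quo U : Type := Quotient.quot (submod_zmod U).
HB.instance Definition _ U := GRing.Zmodule.on (quo U).

Definition quo_pi U : M -> quo U := fun x => \pi_(Quotient.quot (submod_zmod U)) x.

Lemma quo_piP U x y : reflect (quo_pi U x = quo_pi U y) (x - y \in U).
Proof.
have -> : (x - y \in U) = (x - y \in submod_zmod U) by [].
by rewrite Quotient.idealrBE; apply: eqP.
Qed.

Lemma quo_piD U : {morph quo_pi U : x y / x + y}.
Proof. by move=> x y; exact: (raddfD (\pi_(Quotient.quot (submod_zmod U)))). Qed.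

Definition quo_repr U (x : quo U) : M := repr (x : Quotient.quot (submod_zmod U)).

Lemma quo_reprK U : cancel (@quo_repr U) (quo_pi U).
Proof. by move=> x; exact: reprK. Qed.

Definition quo_scale U (a : A) (x : quo U) : quo U := quo_pi U (a *: quo_repr x).

Lemma quo_piZ U a x : quo_pi U (a *: x) = quo_scale a (quo_pi U x).
Proof. by apply/quo_piP; rewrite -scalerBr rpredZ //; apply/quo_piP; rewrite quo_reprK. Qed.

Lemma quo_scaleA U a b (x : quo U) : quo_scale a (quo_scale b x) = quo_scale (a * b) x.
Proof. by rewrite -(quo_reprK x) -!quo_piZ scalerA. Qed.

Lemma quo_scale1 U : left_id 1 (@quo_scale U).
Proof. by move=> x; rewrite -(quo_reprK x) -quo_piZ scale1r. Qed.

Lemma quo_scaleDr U : right_distributive (@quo_scale U) +%R.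
Proof.
move=> a x y; rewrite -(quo_reprK x) -(quo_reprK y).
by rewrite -quo_piD -!quo_piZ -quo_piD scalerDr.
Qed.

Lemma quo_scaleDl U (x : quo U) : {morph (@quo_scale U)^~ x : a b / a + b}.
Proof. by move=> a b; rewrite -(quo_reprK x) -!quo_piZ -quo_piD scalerDl. Qed.

HB.instance Definition _ U := GRing.Zmodule_isLmodule.Build A (quo U)
  (@quo_scaleA U) (@quo_scale1 U) (@quo_scaleDr U) (@quo_scaleDl U).

Lemma quo_pi_linear U : linear (quo_pi U).
Proof. by move=> a x y; rewrite quo_piD quo_piZ. Qed.
HB.instance Definition _ U :=
  GRing.isLinear.Build A M (quo U) *:%R (quo_pi U) (quo_pi_linear U).

End Submodules.

Arguments zero_submod {A} M.
Arguments full_submod {A} M.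
Arguments soc {A} M.
Arguments submod_val {A M} U.
Arguments quo_pi {A M} U.

Section QuotientMaps.
Variable A : pzRingType.

(* The map M/U -> N/V induced by f. *)
Definition quo_map (M N : lmodType A) (U : submodClosed M) (V : submodClosed N)
    (f : {linear M -> N}) (fUV : forall x, x \in U -> f x \in V) : quo U -> quo V :=
  fun x => quo_pi V (f (quo_repr x)).

Lemma quo_map_pi (M N : lmodType A) (U : submodClosed M) (V : submodClosed N)
    (f : {linear M -> N}) (fUV : forall x, x \in U -> f x \in V) x :
  quo_map fUV (quo_pi U x) = quo_pi V (f x).
Proof.
apply/quo_piP; rewrite -linearB fUV //.
by apply/quo_piP; rewrite quo_reprK.
Qed.

Lemma quo_map_linear (M N : lmodType A) (U : submodClosed M) (V : submodClosed N)
    (f : {linear M -> N}) (fUV : forall x, x \in U -> f x \in V) :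
  linear (quo_map fUV).
Proof.
move=> a x y; rewrite -(quo_reprK x) -(quo_reprK y) -linearP !quo_map_pi.
by rewrite !linearP.
Qed.
HB.instance Definition _ (M N : lmodType A) (U : submodClosed M) (V : submodClosed N)
    (f : {linear M -> N}) (fUV : forall x, x \in U -> f x \in V) :=
  GRing.isLinear.Build A (quo U) (quo V) *:%R (quo_map fUV) (quo_map_linear fUV).

(* The canonical epimorphism M/U -> M/V, for U contained in V. *)
Definition quo_epi (M : lmodType A) (U V : submodClosed M)
    (UV : {subset U <= V}) : {linear quo U -> quo V} :=
  @quo_map M M U V idfun UV.

(* The inclusion U/(U :&: V) -> M/V. *)
Definition quo_incl (M : lmodType A) (U V : submodClosed M) :
    {linear quo (submod_in U V) -> quo V} :=
  @quo_map _ _ (submod_in U V) V (submod_val U) (fun _ xV => xV).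

Definition col_map (M N1 N2 : lmodType A)
    (f : {linear M -> N1}) (g : {linear M -> N2}) : M -> N1 * N2 :=
  fun x => (f x, g x).

Lemma col_map_linear (M N1 N2 : lmodType A)
    (f : {linear M -> N1}) (g : {linear M -> N2}) : linear (col_map f g).
Proof. by move=> a x y; rewrite /col_map !linearP. Qed.
HB.instance Definition _ (M N1 N2 : lmodType A)
    (f : {linear M -> N1}) (g : {linear M -> N2}) :=
  GRing.isLinear.Build A M (N1 * N2)%type *:%R (col_map f g) (col_map_linear f g).

Definition row_map (M1 M2 N : lmodType A)
    (f : {linear M1 -> N}) (g : {linear M2 -> N}) : M1 * M2 -> N :=
  fun x => f x.1 + g x.2.

Lemma row_map_linear (M1 M2 N : lmodType A)
    (f : {linear M1 -> N}) (g : {linear M2 -> N}) : linear (row_map f g).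
Proof. by move=> a x y; rewrite /row_map !linearP scalerDr addrACA. Qed.
HB.instance Definition _ (M1 M2 N : lmodType A)
    (f : {linear M1 -> N}) (g : {linear M2 -> N}) :=
  GRing.isLinear.Build A (M1 * M2)%type N *:%R (row_map f g) (row_map_linear f g).

End QuotientMaps.

Section ModuleNotions.
Variable A : pzRingType.
Implicit Types M N P X Y : lmodType A.

Definition finitely_generated M : Prop :=
  exists (n : nat) (s : 'I_n -> M),
    forall x, exists c : 'I_n -> A, x = \sum_(i < n) c i *: s i.

Definition isomorphic M N : Prop := exists f : {linear M -> N}, bijective f.

Definition nonzero M : Prop := exists x : M, x != 0.

Definition indecomposable M : Prop :=
  nonzero M /\
  forall U V : submodClosed M, internal_dsum (full_submod M) U V ->
    U =i zero_submod M \/ V =i zero_submod M.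

Definition projective P : Prop :=
  forall X Y, finitely_generated X -> finitely_generated Y ->
  forall (g : {linear X -> Y}) (f : {linear P -> Y}),
    (forall y, exists x, g x = y) ->
    exists h : {linear P -> X}, forall x, g (h x) = f x.

(* Radical powers; by construction rad^(n.+1) M is the radical of the module
   rad^n M, taken inside M. *)
Definition radn M (n : nat) : submodClosed M :=
  iter n (@rad_submod A M) (full_submod M).

Lemma radn_subS M n : {subset radn M n.+1 <= radn M n}.
Proof. exact: rad_submod_sub. Qed.

(* The least n with rad^n M = 0 (the junk value 0 when there is none, which
   does not happen for finitely generated modules over an artin algebra). *)
Definition loewy_length M : nat :=
  match pselect (exists n, `[< radn M n =i zero_submod M >]) with
  | left e => ex_minn e
  | right _ => 0%N
  end.

(* M = S 0 > S 1 > ... > S n = 0 with simple successive quotients. *)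
Definition composition_series M (n : nat) (S : nat -> submodClosed M) : Prop :=
  [/\ S 0%N =i full_submod M, S n =i zero_submod M &
      forall i, (i < n)%N -> maximal_submod (S i) (S i.+1)].

Definition has_length M (n : nat) : Prop := exists S, @composition_series M n S.

Definition uniserial M : Prop :=
  exists n S, @composition_series M n S /\
    forall n' S', @composition_series M n' S' ->
      n' = n /\ forall i, (i <= n)%N -> S' i =i S i.

Definition one_factor_serial M : Prop := nonzero M /\ uniserial M.

Definition two_factor_serial M : Prop :=
  nonzero M /\
  exists l, [/\ has_length M l, (2 <= l)%N,
    uniserial (quo (radn M (l - 2))) & ~ uniserial (quo (radn M (l - 1)))].

Definition split_mono M N (f : {linear M -> N}) : Prop :=
  exists r : {linear N -> M}, forall x, r (f x) = x.

Definition split_epi M N (g : {linear M -> N}) : Prop :=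
  exists s : {linear N -> M}, forall y, g (s y) = y.

Definition left_almost_split M N (f : {linear M -> N}) : Prop :=
  ~ split_mono f /\
  forall X, finitely_generated X ->
  forall h : {linear M -> X}, ~ split_mono h ->
    exists k : {linear N -> X}, forall x, k (f x) = h x.

Definition right_almost_split M N (g : {linear M -> N}) : Prop :=
  ~ split_epi g /\
  forall X, finitely_generated X ->
  forall h : {linear X -> N}, ~ split_epi h ->
    exists k : {linear X -> M}, forall x, g (k x) = h x.

Definition short_exact M N P (f : {linear M -> N}) (g : {linear N -> P}) : Prop :=
  [/\ injective f, forall y, g y = 0 <-> exists x, f x = y &
      forall z, exists y, g y = z].

(* Almost split sequence 0 -> M -> N -> P -> 0 in the category of finitely
   generated modules. *)
Definition almost_split M N P (f : {linear M -> N}) (g : {linear N -> P}) : Prop :=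
  [/\ finitely_generated M, finitely_generated N & finitely_generated P] /\
  [/\ short_exact f g, left_almost_split f & right_almost_split g].

End ModuleNotions.

Definition artinian (R : comPzRingType) : Prop :=
  forall I : nat -> submodClosed R^o,
    (forall n, {subset I n.+1 <= I n}) ->
    exists n, forall m, (n <= m)%N -> I m =i I n.

Definition artin_algebra (R : comPzRingType) (L : algType R) : Prop :=
  artinian R /\ finitely_generated L.

Definition right_2Nakayama (L : pzRingType) : Prop :=
  (forall M : lmodType L^c, finitely_generated M -> indecomposable M ->
     one_factor_serial M \/ two_factor_serial M) /\
  (exists M : lmodType L^c,
     [/\ finitely_generated M, indecomposable M & two_factor_serial M]).

(* Main.v *)
Require Import Defs.
From HB Require Import structures.
From mathcomp Require Import all_boot all_algebra.
From mathcomp Require Import boolp.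

Set Implicit Arguments.
Unset Strict Implicit.
Unset Printing Implicit Defensive.

Import GRing.Theory.
Local Open Scope ring_scope.

(* Every indecomposable module over a right 2-Nakayama algebra is hollow (it has
   at most one maximal submodule).  Hence a map from an indecomposable X onto a
   quotient P/W of a projective P presents X as P/U with U contained in W, and
   the sequences are seen to be right almost split by inspecting the possible U.
   As the kernel of each sequence has a local endomorphism ring, the left almost
   split property follows from the right one by a pushout argument.  In case (c)
   the possible U include diagonal submodules of S1 + S2; the endomorphism of P
   needed for these comes from the left almost split map U -> P of case (b). *)

(** The sequences are tested directly against all finitely generated modules, so neither a transpose
    nor an existence theorem for almost split sequences enters. Descending chain arguments take the
    place of Krull-Schmidt and of Fitting's lemma. The obstacle is case (c). A map from P/U onto
    P/rad(P), with U strictly inside rad(P), is lifted by x |-> (-phi x, x - phi x), and this kills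
    U exactly when phi restricts on U to the projection onto S1 along S2. Projectivity does not
    extend maps from a submodule. A diagonal U, however, is itself a simple direct summand of
    rad(P); this is why (b) is proved for every simple summand of rad(P) and not only for the two
    given ones. *)

Section SubmoduleConstructions.
Variables (A : pzRingType) (M : lmodType A).
Implicit Types U V W : submodClosed M.

Lemma submodN U x : x \in U -> - x \in U.
Proof. by move=> xU; rewrite -scaleN1r rpredZ. Qed.

Lemma submodB U x y : x \in U -> y \in U -> x - y \in U.
Proof. by move=> xU yU; rewrite rpredD ?submodN. Qed.

Lemma zero_submodE x : (x \in zero_submod M) = (x == 0).
Proof. by []. Qed.

Lemma full_submodE x : x \in full_submod M.
Proof. by []. Qed.

Lemma submod_eq0 U : (forall x, x \in U -> x = 0) -> U =i zero_submod M.
Proof.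
move=> U0 x; rewrite zero_submodE; apply/idP/eqP => [/U0//|->].
exact: rpred0.
Qed.

Lemma submod_eqP U V : {subset U <= V} -> {subset V <= U} -> U =i V.
Proof. by move=> UV VU x; apply/idP/idP => [/UV|/VU]. Qed.

Lemma quo_pi0 U x : quo_pi U x = 0 <-> x \in U.
Proof.
rewrite -(raddf0 (quo_pi U)); split; first by move/quo_piP; rewrite subr0.
by move=> xU; apply/quo_piP; rewrite subr0.
Qed.

Lemma quo_pi_surj U (y : quo U) : exists x, quo_pi U x = y.
Proof. by exists (quo_repr y); exact: quo_reprK. Qed.

Lemma submod_valP U (x : submod_type U) : submod_val U x \in U.
Proof. exact: valP. Qed.

Lemma submod_val_inj U : injective (submod_val U).
Proof. exact: val_inj. Qed.

Lemma submod_val_surj U x : x \in U -> exists y, submod_val U y = x.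
Proof. by move=> xU; exists (exist _ x xU : submod_type U). Qed.

Definition add_pred U V : {pred M} := fun x =>
  `[< exists u v, [/\ u \in U, v \in V & x = u + v] >].

Lemma add_submod_closed U V : subsemimod_closed (add_pred U V).
Proof.
split=> [|a _ /asboolP[u [v [uU vV ->]]]]; last first.
  by apply/asboolP; exists (a *: u), (a *: v); rewrite !rpredZ ?scalerDr.
split=> [|_ _ /asboolP[u [v [uU vV ->]]] /asboolP[u' [v' [uU' vV' ->]]]].
  by apply/asboolP; exists 0, 0; rewrite !rpred0 addr0.
by apply/asboolP; exists (u + u'), (v + v'); rewrite !rpredD // addrACA.
Qed.
HB.instance Definition _ U V :=
  GRing.isSubmodClosed.Build A M (add_pred U V) (add_submod_closed U V).
Definition add_submod U V : submodClosed M := add_pred U V.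

Lemma add_submodP U V x :
  reflect (exists u v, [/\ u \in U, v \in V & x = u + v]) (x \in add_submod U V).
Proof. exact: asboolP. Qed.

Lemma add_submodl U V : {subset U <= add_submod U V}.
Proof. by move=> x xU; apply/add_submodP; exists x, 0; rewrite rpred0 addr0. Qed.

Lemma add_submodr U V : {subset V <= add_submod U V}.
Proof. by move=> x xV; apply/add_submodP; exists 0, x; rewrite rpred0 add0r. Qed.

Lemma add_submod_sub U V W :
  {subset U <= W} -> {subset V <= W} -> {subset add_submod U V <= W}.
Proof. by move=> UW VW _ /add_submodP[u [v [/UW uW /VW vW ->]]]; rewrite rpredD. Qed.

Lemma internal_dsumC W U V : internal_dsum W U V -> internal_dsum W V U.
Proof.
case=> UW VW UV UV0; split=> // [x /UV[u [v [uU vV ->]]]|x xV xU]; last exact: UV0.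
by exists v, u; rewrite addrC.
Qed.

Definition cap_pred U V : {pred M} := fun x => (x \in U) && (x \in V).

Lemma cap_submod_closed U V : subsemimod_closed (cap_pred U V).
Proof.
split=> [|a x /andP[xU xV]]; last by apply/andP; rewrite !rpredZ.
split=> [|x y /andP[xU xV] /andP[yU yV]]; first by apply/andP; rewrite !rpred0.
by apply/andP; rewrite !rpredD.
Qed.
HB.instance Definition _ U V :=
  GRing.isSubmodClosed.Build A M (cap_pred U V) (cap_submod_closed U V).
Definition cap_submod U V : submodClosed M := cap_pred U V.

Lemma cap_submodE U V x : (x \in cap_submod U V) = (x \in U) && (x \in V).
Proof. by []. Qed.

End SubmoduleConstructions.

(** * Linear maps: images, factorizations and splittings *)

Section Linear.
Variable A : pzRingType.
Implicit Types M N K X : lmodType A.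

Section ImagePreimage.
Variables (M N : lmodType A) (f : {linear M -> N}).

Definition im_pred (U : submodClosed M) : {pred N} := fun y =>
  `[< exists2 x, x \in U & y = f x >].

Lemma im_submod_closed U : subsemimod_closed (im_pred U).
Proof.
split=> [|a _ /asboolP[x xU ->]]; last first.
  by apply/asboolP; exists (a *: x); rewrite ?linearZ ?rpredZ.
split=> [|_ _ /asboolP[x xU ->] /asboolP[y yU ->]]; apply/asboolP.
  by exists 0; rewrite ?rpred0 ?raddf0.
by exists (x + y); rewrite ?rpredD ?raddfD.
Qed.
HB.instance Definition _ U :=
  GRing.isSubmodClosed.Build A N (im_pred U) (im_submod_closed U).
Definition im_submod U : submodClosed N := im_pred U.

Lemma im_submodP (U : submodClosed M) y :
  reflect (exists2 x, x \in U & y = f x) (y \in im_submod U).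
Proof. exact: asboolP. Qed.

Lemma im_submod_mem (U : submodClosed M) x : x \in U -> f x \in im_submod U.
Proof. by move=> xU; apply/im_submodP; exists x. Qed.

Definition preim_pred (V : submodClosed N) : {pred M} := fun x => f x \in V.

Lemma preim_submod_closed V : subsemimod_closed (preim_pred V).
Proof.
have inV x : (x \in preim_pred V) = (f x \in V) by [].
split=> [|a x xV]; last by rewrite inV linearZ rpredZ -?inV.
by split=> [|x y xV yV]; rewrite inV ?raddf0 ?rpred0 // raddfD rpredD -?inV.
Qed.
HB.instance Definition _ V :=
  GRing.isSubmodClosed.Build A M (preim_pred V) (preim_submod_closed V).
Definition preim_submod V : submodClosed M := preim_pred V.

Lemma preim_submodE V x : (x \in preim_submod V) = (f x \in V).
Proof. by []. Qed.

End ImagePreimage.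

Lemma linear_map M N (k : M -> N) : linear k -> exists k' : {linear M -> N}, k' =1 k.
Proof.
move=> klin; pose k' : {linear M -> N} :=
  HB.pack k (GRing.isLinear.Build A M N *:%R k klin).
by exists k'.
Qed.

(** Preimages are chosen pointwise; injectivity of [f] makes the chosen function linear. *)
Lemma lin_lift M N X (f : {linear M -> N}) (h : {linear X -> N}) :
  injective f -> (forall x, exists y, f y = h x) ->
  exists k : {linear X -> M}, forall x, f (k x) = h x.
Proof.
move=> finj /choice[k kP].
have [|k' k'E] := @linear_map _ _ k; last by exists k' => x; rewrite k'E.
by move=> a x y; apply: finj; rewrite linearP !kP linearP.
Qed.

(** Dual to [lin_lift]: compose [h] with a set-theoretic section of [g]; the kernel condition makes
    the choice of section irrelevant. *)
Lemma lin_desc M N X (g : {linear M -> N}) (h : {linear M -> X}) :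
  (forall y, exists x, g x = y) -> (forall x, g x = 0 -> h x = 0) ->
  exists k : {linear N -> X}, forall x, k (g x) = h x.
Proof.
move=> /choice[s sP] gh.
have gE x y : g x = g y -> h x = h y.
  by move=> gxy; apply/subr0_eq; rewrite -linearB gh // linearB gxy subrr.
have [|k kE] := @linear_map _ _ (h \o s); last by exists k => x; rewrite kE /=; apply: gE.
by move=> a x y /=; rewrite -linearP; apply: gE; rewrite linearP !sP.
Qed.

Lemma linear_inj M N (f : {linear M -> N}) :
  (forall x, f x = 0 -> x = 0) -> injective f.
Proof. by move=> f0 x y fxy; apply/subr0_eq/f0; rewrite linearB fxy subrr. Qed.

Lemma quo_desc M X (U : submodClosed M) (h : {linear M -> X}) :
  (forall x, x \in U -> h x = 0) ->
  exists k : {linear quo U -> X}, forall x, k (quo_pi U x) = h x.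
Proof.
move=> hU; apply: lin_desc => [|x /quo_pi0/hU//]; exact: quo_pi_surj.
Qed.

Lemma fg_surj M N (g : {linear M -> N}) :
  (forall y, exists x, g x = y) -> finitely_generated M -> finitely_generated N.
Proof.
move=> gsurj [n [s sP]]; exists n, (g \o s) => y.
have [x <-] := gsurj y; have [c ->] := sP x; exists c.
by rewrite linear_sum; apply: eq_bigr => i _; rewrite linearZ.
Qed.

Lemma fg_quo M (U : submodClosed M) :
  finitely_generated M -> finitely_generated (quo U).
Proof. exact/fg_surj/quo_pi_surj. Qed.

Lemma fg_prod M N : finitely_generated M -> finitely_generated N ->
  finitely_generated (M * N)%type.
Proof.
move=> [m [s sP]] [n [r rP]].
pose g (i : 'I_(m + n)) : M * N :=
  match split i with inl j => (s j, 0) | inr j => (0, r j) end.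
exists (m + n)%N, g => -[x y]; have [c ->] := sP x; have [d ->] := rP y.
exists (fun i => match split i with inl j => c j | inr j => d j end).
rewrite big_split_ord /=.
have splitl i : split (lshift n i) = inl i by exact: (unsplitK (inl i)).
have splitr i : split (rshift m i) = inr i by exact: (unsplitK (inr i)).
pose i1 : {linear M -> (M * N)%type} := col_map idfun \0.
pose i2 : {linear N -> (M * N)%type} := col_map \0 idfun.
rewrite (eq_bigr (fun i => i1 (c i *: s i))) => [|i _]; last by rewrite /g splitl linearZ.
rewrite [X in _ = _ + X](eq_bigr (fun i => i2 (d i *: r i))) => [|i _];
  last by rewrite /g splitr linearZ.
rewrite -!linear_sum /= /i1 /i2 /col_map.
by congr pair; rewrite /= ?addr0 ?add0r.
Qed.

(** For nonzero [K] this says that End(K) is local. Left inverses suffice for the definition, and a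
    retraction is the form in which it gets applied. *)
Definition local_end K : Prop := forall phi : {linear K -> K},
  split_mono phi \/ split_mono (idfun \- phi).

Lemma split_mono_comp M N X (f : {linear M -> N}) (g : {linear N -> X}) :
  split_mono (g \o f) -> split_mono f.
Proof. by case=> r rP; exists (r \o g). Qed.

Lemma split_mono_inj M N (f : {linear M -> N}) : split_mono f -> injective f.
Proof. by case=> r rP; exact: can_inj rP. Qed.

Lemma bij_split_mono M N (f : {linear M -> N}) :
  injective f -> (forall y, exists x, f x = y) -> split_mono f.
Proof.
move=> finj fsurj.
have [||k kP] := @lin_desc _ _ _ f idfun; [exact: fsurj| |by exists k].
by move=> x fx0; apply: finj; rewrite raddf0.
Qed.

Lemma bij_split_epi M N (f : {linear M -> N}) :
  injective f -> (forall y, exists x, f x = y) -> split_epi f.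
Proof.
move=> finj fsurj; have [s sP] := @lin_lift _ _ _ f idfun finj fsurj.
by exists s.
Qed.

(** A retraction of the column writes the identity of [K] as [r1 f + r2 g], and locality makes one
    of the two summands left invertible. *)
Lemma split_mono_col K M N (f : {linear K -> M}) (g : {linear K -> N}) :
  local_end K -> split_mono (col_map f g) -> split_mono f \/ split_mono g.
Proof.
move=> locK [r rP].
pose r1 : {linear M -> K} := r \o col_map idfun \0.
pose r2 : {linear N -> K} := r \o col_map \0 idfun.
have rE x : r1 (f x) + r2 (g x) = x.
  by rewrite -[RHS]rP /r1 /r2 /= -raddfD /= /col_map; congr (r (_, _)); rewrite /= ?addr0 ?add0r.
case: (locK (r1 \o f)) => [|[s sP]]; first by left; apply: split_mono_comp; eassumption.
right; exists (s \o r2) => x /=; rewrite -[RHS]sP /=; congr (s _).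
by rewrite -[X in X - _](rE x) addrC addKr.
Qed.

(** For a section [s] of [g], the map 1 - sg lands in the kernel of [g], so it factors through [f];
    the factor is the retraction. *)
Lemma split_epi_mono M N X (f : {linear M -> N}) (g : {linear N -> X}) :
  short_exact f g -> split_epi g -> split_mono f.
Proof.
case=> finj exact gsurj [s sP].
have [|r rP] := @lin_lift _ _ _ f (idfun \- (s \o g)) finj.
  by move=> y; apply/exact; rewrite /= raddfB /= sP subrr.
exists r => x; apply: finj; rewrite rP /=.
by have -> : g (f x) = 0; [apply/exact; exists x|rewrite raddf0 subr0].
Qed.

Lemma split_mono_epi M N X (f : {linear M -> N}) (g : {linear N -> X}) :
  short_exact f g -> split_mono f -> split_epi g.
Proof.
case=> finj exact gsurj [r rP].
have [||s sP] := @lin_desc _ _ _ g (idfun \- (f \o r)); first exact: gsurj.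
  by move=> _ /exact[x <-] /=; rewrite rP subrr.
exists s => y; have [x <-] := gsurj y; rewrite sP /= raddfB /=.
by have -> : g (f (r x)) = 0; [apply/exact; eexists|rewrite subr0].
Qed.

(* Form the pushout N of f along h : K -> X.  If N -> M splits then h extends
   to E.  Otherwise N -> M factors through g, and restricting the factorization
   to X gives kappa : X -> K with kappa h - 1 = rho f for some rho : E -> K; as
   End(K) is local, this forces h or f to split. *)
Lemma left_almost_split_local K (E : lmodType A) M (f : {linear K -> E})
    (g : {linear E -> M}) :
  finitely_generated E -> short_exact f g -> local_end K ->
  right_almost_split g -> left_almost_split f.
Proof.
move=> fgE fg_exact locK [gns gP].
have fns : ~ split_mono f by move/(split_mono_epi fg_exact).
split=> // X fgX h hns; case: (fg_exact) => finj exact gsurj.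
(* The pushout is E + X modulo the copy of [K] embedded by (f, -h). *)
pose D := im_submod (col_map f (\- h)) (full_submod K).
pose Q : lmodType A := quo D.
have [iE iEP] : exists iE : {linear E -> Q}, forall e, iE e = quo_pi D (e, 0).
  by exists (quo_pi D \o col_map idfun \0).
have [iX iXP] : exists iX : {linear X -> Q}, forall x, iX x = quo_pi D (0, x).
  by exists (quo_pi D \o col_map \0 idfun).
have DP e x : reflect (exists2 k, e = f k & x = - h k) ((e, x) \in D).
  apply: (iffP (im_submodP _ _ _)) => [[k _ []]|[k -> ->]]; first by exists k.
  by exists k.
have fhE k : iE (f k) = iX (h k).
  rewrite iEP iXP; apply/quo_piP/DP; exists k; first by rewrite /= subr0.
  by rewrite /= sub0r.
have iX_inj : injective iX.
  apply: linear_inj => x; rewrite iXP => /quo_pi0/DP[k /= /esym fk0 ->].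
  have -> : k = 0 by apply: finj; rewrite fk0 raddf0.
  by rewrite raddf0 oppr0.
have [z|g' g'P] := @quo_desc _ _ D (g \o fst).
  by case: z => e x /DP[k -> _] /=; apply/exact; exists k.
have g'E e : g' (iE e) = g e by rewrite iEP g'P.
have g'X x : g' (iX x) = 0 by rewrite iXP g'P /= raddf0.
have ker_g' y : g' y = 0 -> exists x, iX x = y.
  have [[e x] <-] := quo_pi_surj y; rewrite g'P /= => /exact[k <-].
  exists (x + h k); rewrite iXP; apply/quo_piP/DP; exists (- k).
    by rewrite /= raddfN sub0r.
  by rewrite /= raddfN opprK addrC addKr.
have [[s sP]|nsplit] := EM (split_epi g').
  (* [iE - s g] is killed by [g'], so it factors through [iX]; as [g f = 0], the factor restricts
     along [f] to [h]. *)
  have [e|k kP] := @lin_lift _ _ _ iX (iE \- (s \o g)) iX_inj.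
    by apply: ker_g'; rewrite /= raddfB /= sP g'E subrr.
  exists k => x; apply: iX_inj; rewrite kP -fhE /=.
  by have -> : g (f x) = 0; [apply/exact; exists x|rewrite raddf0 subr0].
have fgD : finitely_generated (quo D) by apply/fg_quo/fg_prod.
have [k kP] := gP _ fgD g' nsplit.
have [x|kappa kappaP] := @lin_lift _ _ _ f (k \o iX) finj.
  by apply/exact; rewrite /= kP g'X.
(* [k iE] and the identity of [E] agree after [g]; [rho] records their difference in [K]. *)
have [e|rho rhoP] := @lin_lift _ _ _ f ((k \o iE) \- idfun) finj.
  by apply/exact; rewrite /= raddfB /= kP g'E subrr.
have rhoE x : kappa (h x) = rho (f x) + x.
  by apply: finj; rewrite kappaP raddfD /= rhoP /= fhE subrK.
case: (locK (kappa \o h)) => [|[r rP]]; first by move/split_mono_comp/hns.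
case: fns; exists (r \o (\- rho)) => x.
by rewrite -[RHS]rP /= rhoE opprD subrKC.
Qed.

(** * Hollow modules, descending chains and local endomorphism rings *)

Definition hollow M : Prop := forall U V : submodClosed M,
  (forall x, x \in add_submod U V) -> (forall x, x \in U) \/ (forall x, x \in V).

Definition submod_total M : Prop := forall U V : submodClosed M,
  {subset U <= V} \/ {subset V <= U}.

Definition submod_dcc M : Prop := forall I : nat -> submodClosed M,
  (forall n, {subset I n.+1 <= I n}) ->
  exists n, forall m, (n <= m)%N -> I m =i I n.

Lemma total_hollow M : submod_total M -> hollow M.
Proof.
move=> totM U V UV; have [sUV|sVU] := totM U V.
  by right=> x; apply: (add_submod_sub sUV _ (UV x)).
by left=> x; apply: (add_submod_sub _ sVU (UV x)).
Qed.

Lemma hollow_indecomposable M : hollow M -> nonzero M -> indecomposable M.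
Proof.
move=> hM nzM; split=> // U V [_ _ UV UV0].
case: (hM U V) => [x|Ux|Vx]; first by apply/add_submodP; exact: UV.
- by right; apply: submod_eq0 => x; exact: UV0.
- by left; apply: submod_eq0 => x xU; exact: UV0.
Qed.

Lemma indecomposable_dsum M (U V : submodClosed M) : indecomposable M ->
  (forall x, x \in add_submod U V) -> (forall x, x \in U -> x \in V -> x = 0) ->
  (forall x, x \in U -> x = 0) \/ (forall x, x \in V -> x = 0).
Proof.
move=> [_ indM] UV UV0; case: (indM U V) => [|U0|V0].
- by split=> // x _; apply/add_submodP.
- by left=> x; rewrite U0 zero_submodE => /eqP.
- by right=> x; rewrite V0 zero_submodE => /eqP.
Qed.

Lemma im_submod_val M (U : submodClosed M) (Y : submodClosed (submod_type U)) x :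
  (submod_val U x \in im_submod (submod_val U) Y) = (x \in Y).
Proof. by apply/im_submodP/idP => [[y yY /submod_val_inj->]//|xY]; exists x. Qed.

Lemma total_submod M (U : submodClosed M) :
  submod_total M -> submod_total (submod_type U).
Proof.
move=> totM V W.
have [VW|WV] := totM (im_submod (submod_val U) V) (im_submod (submod_val U) W).
  by left=> x; rewrite -!im_submod_val; exact: VW.
by right=> x; rewrite -!im_submod_val; exact: WV.
Qed.

Lemma total_quo M (U : submodClosed M) : submod_total M -> submod_total (quo U).
Proof.
move=> totM V W.
have [VW|WV] := totM (preim_submod (quo_pi U) V) (preim_submod (quo_pi U) W).
  by left=> y; have [x <-] := quo_pi_surj y; exact: VW.
by right=> y; have [x <-] := quo_pi_surj y; exact: WV.
Qed.

(** The images of the powers of [phi] become stationary; injectivity cancels [phi] from the equality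
    of two successive images until the whole module is reached. *)
Lemma dcc_inj_surj M (phi : {linear M -> M}) :
  submod_dcc M -> injective phi -> forall y, exists x, phi x = y.
Proof.
move=> dccM phi_inj; pose I n := iter n (im_submod phi) (full_submod M).
have im_mono (U V : submodClosed M) :
    {subset U <= V} -> {subset im_submod phi U <= im_submod phi V}.
  by move=> UV _ /im_submodP[x /UV xV ->]; exact: im_submod_mem.
have [|n nP] := dccM I; first by elim=> // n IHn; exact: im_mono.
have {nP} : {subset I n <= I n.+1} by move=> x; rewrite -(nP n.+1).
elim: n => [I0 y|n IHn In]; last first.
  apply: IHn => x xI; have /In/im_submodP[y yI /phi_inj->//] : phi x \in I n.+1.
  exact: im_submod_mem.
by have /I0/im_submodP[x _ ->] := full_submodE y; exists x.
Qed.

(** The kernels of [phi] and 1 - [phi] meet in zero and are comparable, so one of them vanishes; an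
    injective endomorphism is bijective by the chain condition. *)
Lemma local_end_total M : submod_total M -> submod_dcc M -> local_end M.
Proof.
move=> totM dccM phi.
have split_inj (psi : {linear M -> M}) :
    (forall x, psi x = 0 -> x = 0) -> split_mono psi.
  by move=> /linear_inj psi_inj; apply: bij_split_mono => //; exact: dcc_inj_surj.
pose ker (psi : {linear M -> M}) := preim_submod psi (zero_submod M).
have kerP (psi : {linear M -> M}) x : psi x = 0 <-> x \in ker psi.
  by rewrite preim_submodE zero_submodE; split=> /eqP.
have [le12|le21] := totM (ker phi) (ker (idfun \- phi)).
  left; apply: split_inj => x phix0; have /kerP/le12/kerP/= := phix0.
  by rewrite phix0 subr0.
right; apply: split_inj => x psix0; have /kerP/le21/kerP phix0 := psix0.
by move: psix0; rewrite /= phix0 subr0.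
Qed.

(** The images of [phi] and 1 - [phi] add up to [M], so by hollowness one of the maps is onto. It
    splits by projectivity, and indecomposability kills its kernel. *)
Lemma local_end_projective M : finitely_generated M -> projective M ->
  hollow M -> indecomposable M -> local_end M.
Proof.
move=> fgM projM hM indM phi.
have split_surj (psi : {linear M -> M}) :
    (forall x, x \in im_submod psi (full_submod M)) -> split_mono psi.
  move=> psi_surj.
  have [y|s sP] := projM M M fgM fgM psi idfun.
    by have /im_submodP[x _ ->] := psi_surj y; exists x.
  have dsum x : x \in add_submod (im_submod s (full_submod M)) (preim_submod psi (zero_submod M)).
    apply/add_submodP; exists (s (psi x)), (x - s (psi x)); rewrite subrKC.
    by split=> //; rewrite ?im_submod_mem // preim_submodE zero_submodE raddfB /= sP subrr.
  case: (indecomposable_dsum indM dsum) => [x /im_submodP[y _ ->]|s0|ker0].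
  - by rewrite preim_submodE zero_submodE sP => /eqP/= ->; rewrite raddf0.
  - case: indM => -[x /eqP[]]; rewrite -[x]sP /= -(raddf0 psi); congr (psi _).
    by apply: s0; exact: im_submod_mem.
  exists s => x; apply/subr0_eq/ker0.
  by rewrite preim_submodE zero_submodE raddfB /= sP subrr.
case: (hM (im_submod phi (full_submod M)) (im_submod (idfun \- phi) (full_submod M))).
- move=> x; apply/add_submodP; exists (phi x), (x - phi x); rewrite subrKC.
  by split=> //; apply/im_submodP; exists x.
- by move=> phi_surj; left; exact: split_surj.
- by move=> phi_surj; right; exact: split_surj.
Qed.

(** Well-founded induction: a counterexample would yield, by iterated choice, a strictly descending
    chain of counterexamples. *)
Lemma dcc_ind M (Q : submodClosed M -> Prop) : submod_dcc M ->
  (forall U : submodClosed M,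
    (forall V : submodClosed M, {subset V <= U} -> ~ {subset U <= V} -> Q V) -> Q U) ->
  forall U, Q U.
Proof.
move=> dccM QP U; apply: contrapT => nQU.
have step (W : {W | ~ Q W}) :
    {V : {V | ~ Q V} | {subset sval V <= sval W} & ~ {subset sval W <= sval V}}.
  apply: cid2; case: W => W nQW /=; apply: contrapT => noV; apply/nQW/QP => V VW nWV.
  by apply: contrapT => nQV; apply: noV; exists (exist _ V nQV).
pose I n := iter n (fun W => s2val (step W)) (exist _ U nQU).
have [n|n nP] := dccM (fun n => sval (I n)); first by rewrite /I /=; case: (step _).
have := nP n.+1 (leqnSn n); rewrite /I /=; case: (step _) => V VI nIV /= eqI.
by apply: nIV => x; rewrite -eqI.
Qed.

Lemma dsum_val_inj M (U V : submodClosed M) :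
  (forall x, x \in U -> x \in V -> x = 0) ->
  injective (row_map (submod_val U) (submod_val V)).
Proof.
move=> UV0; apply: linear_inj => -[u v] /= uv0.
have uE : submod_val U u = - submod_val V v.
  by apply/eqP; rewrite -addr_eq0; apply/eqP.
have u0 : submod_val U u = 0.
  by apply: UV0; [|rewrite uE submodN]; rewrite ?submod_valP.
congr (_, _); apply: submod_val_inj; rewrite raddf0 //.
by rewrite -[LHS]opprK -uE u0 oppr0.
Qed.

Lemma dsum_proj M (U V : submodClosed M) :
  internal_dsum (full_submod M) U V ->
  exists (pU : {linear M -> submod_type U}) (pV : {linear M -> submod_type V}),
    [/\ forall x, x = submod_val U (pU x) + submod_val V (pV x),
        forall x, pU (submod_val U x) = x & forall x, pV (submod_val V x) = x].
Proof.
move=> [_ _ UV UV0].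
pose s : {linear (submod_type U * submod_type V)%type -> M} := row_map (submod_val U) (submod_val V).
have s_inj : injective s := dsum_val_inj UV0.
have [x|r rP] := @lin_lift _ _ _ s idfun s_inj.
  have [//|u [v [/submod_val_surj[u' <-] /submod_val_surj[v' <-] ->]]] := UV x.
  by exists (u', v').
exists (fst \o r), (snd \o r); split=> x; first by rewrite -[LHS]rP.
  by rewrite /=; have -> // : r (submod_val U x) = (x, 0);
    apply: s_inj; rewrite rP /= /row_map /= raddf0 addr0.
by rewrite /=; have -> // : r (submod_val V x) = (0, x);
    apply: s_inj; rewrite rP /= /row_map /= raddf0 add0r.
Qed.

(** Decomposing the test module into two summands and recursing replaces a decomposition into
    indecomposables: a section over a summand would be a section of the whole map, so the hypothesis
    passes to both summands. *)
Lemma right_almost_split_indec (E : lmodType A) M (g : {linear E -> M}) :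
  (forall X, finitely_generated X -> submod_dcc X) ->
  ~ split_epi g ->
  (forall X, finitely_generated X -> indecomposable X ->
   forall h : {linear X -> M}, ~ split_epi h ->
     exists k : {linear X -> E}, forall x, g (k x) = h x) ->
  right_almost_split g.
Proof.
move=> dcc nsg gP; split=> // X fgX.
(* The induction runs over submodules of the fixed [X], while the test module is any [Z] embedded
   with image [U]; summands of [Z] then need no identification with submodules of [X]. *)
suff gX (U : submodClosed X) : forall Z, finitely_generated Z ->
    forall e : {linear Z -> X}, injective e -> (forall x, x \in U <-> exists z, e z = x) ->
    forall h : {linear Z -> M}, ~ split_epi h ->
    exists k : {linear Z -> E}, forall z, g (k z) = h z.
  apply: (gX (full_submod X) X fgX idfun) => // x.
  by split=> // _; exists x.
move: U; apply: (dcc_ind (dcc X fgX)) => U IHU Z fgZ e e_inj eU h nsh.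
have [indZ|nindZ] := EM (indecomposable Z); first exact: gP.
have [nzZ|Z0] := EM (nonzero Z); last first.
  exists \0 => z; have -> : z = 0 by apply: contrapT => /eqP nz; apply: Z0; exists z.
  by rewrite !raddf0.
have [V [W [dVW nV nW]]] : exists V W : submodClosed Z,
    [/\ internal_dsum (full_submod Z) V W,
     ~ V =i zero_submod Z & ~ W =i zero_submod Z].
  apply: contrapT => noVW; apply: nindZ; split=> // V W dVW.
  have [V0|nV] := EM (V =i zero_submod Z); first by left.
  have [W0|nW] := EM (W =i zero_submod Z); first by right.
  by case: noVW; exists V, W.
have [pV [pW [VWE pVK pWK]]] := dsum_proj dVW.
have summand (Y Y' : submodClosed Z) (pY : {linear Z -> submod_type Y}) :
    internal_dsum (full_submod Z) Y Y' -> ~ Y' =i zero_submod Z ->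
    (forall x, pY (submod_val Y x) = x) ->
    exists k : {linear submod_type Y -> E}, forall x, g (k x) = h (submod_val Y x).
  move=> [_ _ _ YY'0] nY' pYK.
  apply: (IHU (im_submod e Y) _ _ (submod_type Y) _ (e \o submod_val Y) _ _ (h \o submod_val Y)).
  - by move=> _ /im_submodP[y _ ->]; apply/eU; exists y.
  - move=> UY; apply: nY'; apply: submod_eq0 => y yY'.
    apply: YY'0 => //; have /UY/im_submodP[y' y'Y /e_inj->//] : e y \in U by apply/eU; exists y.
  - by apply: (fg_surj (g := pY)) => // x; exists (submod_val Y x).
  - by apply: inj_comp => //; exact: submod_val_inj.
  - move=> x; split=> [/im_submodP[y /submod_val_surj[z <-] ->]|[z <-]]; first by exists z.
    by apply: im_submod_mem; exact: submod_valP.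
  - by case=> s sP; apply: nsh; exists (submod_val Y \o s).
have dWV := internal_dsumC dVW.
have [kV kVP] := summand V W pV dVW nW pVK.
have [kW kWP] := summand W V pW dWV nV pWK.
exists ((kV \o pV) \+ (kW \o pW)) => z.
by rewrite /= raddfD /= kVP kWP -raddfD -VWE.
Qed.

(** * The descending chain condition for finitely generated modules *)

Lemma submod_dcc_ext M (U : submodClosed M) :
  submod_dcc (submod_type U) -> submod_dcc (quo U) -> submod_dcc M.
Proof.
move=> dccU dccQ I Idec.
have Imono m n : (m <= n)%N -> {subset I n <= I m}.
  elim: n => [|n IHn]; first by rewrite leqn0 => /eqP->.
  by rewrite leq_eqVlt => /predU1P[->//|/IHn In] x /Idec/In.
have [|n1 n1P] := dccU (fun n => preim_submod (submod_val U) (I n)).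
  by move=> n x; exact: Idec.
have [|n2 n2P] := dccQ (fun n => im_submod (quo_pi U) (I n)).
  by move=> n _ /im_submodP[x /Idec xI ->]; exact: im_submod_mem.
exists (maxn n1 n2) => m; rewrite geq_max => /andP[n1m n2m].
apply: submod_eqP; first by apply: Imono; rewrite geq_max n1m.
(* Modular law: stationarity in the quotient gives y in [I m] with x - y in [U], and stationarity
   inside [U] puts x - y into [I m]. *)
move=> x xI; have xI1 := Imono _ _ (leq_maxl n1 n2) _ xI.
have /(im_submod_mem (quo_pi U)) := Imono _ _ (leq_maxr n1 n2) _ xI.
rewrite -(n2P _ n2m) => /im_submodP[y yI /quo_piP/submod_val_surj[z zxy]].
suff : z \in preim_submod (submod_val U) (I m).
  by rewrite preim_submodE /= zxy => xyI; rewrite -(subrK y x) rpredD.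
by rewrite (n1P _ n1m) preim_submodE /= zxy submodB // (Imono _ _ n1m).
Qed.

Lemma submod_dcc_surj M N (g : {linear M -> N}) :
  (forall y, exists x, g x = y) -> submod_dcc M -> submod_dcc N.
Proof.
move=> gsurj dccM I Idec.
have [|n nP] := dccM (fun n => preim_submod g (I n)); first by move=> n x; exact: Idec.
by exists n => m /nP eqI y; have [x <-] := gsurj y; exact: eqI.
Qed.

(** Induction on the number of generators: the first one spans a quotient of the regular module, and
    the others generate the quotient by that span. *)
Lemma submod_dcc_fg M : submod_dcc A^o -> finitely_generated M -> submod_dcc M.
Proof.
move=> dccA [n]; elim: n M => [|n IHn] M [s sP].
  move=> I _; exists 0%N => m _ x; have [c ->] := sP x.
  by rewrite big_ord0 !rpred0.
have [|g gE] := @linear_map A^o M (fun a : A => a *: s ord0).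
  by move=> a b c; rewrite scalerDl scalerA.
pose U := im_submod g (full_submod A^o).
apply: (@submod_dcc_ext _ U).
  have [a|h hP] := @lin_lift _ _ _ (submod_val U) g (@submod_val_inj _ _ U).
    by apply: submod_val_surj; exact: im_submod_mem.
  apply: (@submod_dcc_surj _ _ h) => // y.
  have /im_submodP[a _ ga] := submod_valP y.
  by exists a; apply: submod_val_inj; rewrite hP.
apply: IHn; exists (fun i => quo_pi U (s (lift ord0 i))) => y.
have [x <-] := quo_pi_surj y; have [c ->] := sP x; exists (fun i => c (lift ord0 i)).
rewrite big_ord_recl raddfD /= (_ : quo_pi U _ = 0) ?add0r.
  by rewrite linear_sum; apply: eq_bigr => i _; rewrite linearZ.
by apply/quo_pi0; rewrite -gE; exact: im_submod_mem.
Qed.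

End Linear.

Section ScalarRestriction.
Variables (R : comPzRingType) (L : algType R) (U : submodClosed (L^c)^o).

Definition restrict_pred : {pred L} := fun x => (x : (L^c)^o) \in U.

Lemma restrict_submod_closed : subsemimod_closed restrict_pred.
Proof.
have inU x : (x \in restrict_pred) = ((x : (L^c)^o) \in U) by [].
split=> [|a x]; last first.
  (* Scaling by [a%:A] over the converse ring is right multiplication by it in [L], which is the
     action of [a]. *)
  rewrite !inU -mulr_algr => xU.
  exact: (@rpredZ L^c (L^c)^o U (a%:A : L^c) (x : (L^c)^o) xU).
split=> [|x y]; rewrite !inU; first exact: (rpred0 U).
exact: (@rpredD _ U).
Qed.
HB.instance Definition _ :=
  GRing.isSubmodClosed.Build R L restrict_pred restrict_submod_closed.
Definition restrict_submod : submodClosed L := restrict_pred.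

End ScalarRestriction.

(* A submodule of L over L^c is in particular an R-submodule, so the descending
   chain condition passes from R to L and then to finitely generated modules. *)
Lemma artin_algebra_dcc (R : comPzRingType) (L : algType R) (M : lmodType L^c) :
  artin_algebra L -> finitely_generated M -> submod_dcc M.
Proof.
move=> [artR fgL]; apply: submod_dcc_fg.
have dccL : submod_dcc L by apply: submod_dcc_fg.
move=> I Idec; have [|n nP] := dccL (fun n => restrict_submod (I n)).
  by move=> n x; exact: Idec.
by exists n.
Qed.

(** * Composition series through a given submodule *)

Section CompositionSeries.
Variables (A : pzRingType) (M : lmodType A).
Implicit Types U V W : submodClosed M.

Lemma maximal_submod_eql U U' V : U =i U' -> maximal_submod U V -> maximal_submod U' V.
Proof.
move=> UU' [VU nUV maxV]; split=> [x /VU|U'V|W VW WU']; first by rewrite UU'.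
  by apply: nUV => x; rewrite UU' => /U'V.
have [//|x /WU'|WV|WU] := maxV W; [by rewrite UU'|by left|right=> x].
by rewrite WU UU'.
Qed.

(** (U+W)/(V+W) is a quotient of the simple module U/V; an intermediate [Y] is detected by its
    intersection with [U]. *)
Lemma maximal_submod_add U V W : maximal_submod U V ->
  add_submod U W =i add_submod V W \/
  maximal_submod (add_submod U W) (add_submod V W).
Proof.
move=> [VU nUV maxV].
have VWUW : {subset add_submod V W <= add_submod U W}.
  by apply: add_submod_sub => [x /VU xU|]; [exact: add_submodl|exact: add_submodr].
have [UWVW|nUWVW] := EM {subset add_submod U W <= add_submod V W}.
  by left; exact: submod_eqP.
right; split=> // Y VWY YUW.
have VY x (xV : x \in V) : x \in Y by apply/VWY/add_submodl.
have WY x (xW : x \in W) : x \in Y by apply/VWY/add_submodr.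
case: (maxV (cap_submod U Y)) => [x xV|x /andP[]//|capV|capU].
- by rewrite cap_submodE VU ?VY.
- left; apply: submod_eqP => // y yY; have /add_submodP[u [w [uU wW yE]]] := YUW y yY.
  apply/add_submodP; exists u, w; split=> //.
  have uE : u = y - w by rewrite yE addrK.
  by rewrite -capV cap_submodE uU uE submodB // WY.
- right; apply: submod_eqP => //; apply: add_submod_sub => // x xU.
  by move: xU; rewrite -capU => /andP[].
Qed.

(** The intersection of [U] with [W], modulo that of [V] with [W], embeds into the simple module
    U/V; an intermediate [Y] is detected by [Y + V]. *)
Lemma maximal_submod_cap U V W : maximal_submod U V ->
  cap_submod U W =i cap_submod V W \/
  maximal_submod (cap_submod U W) (cap_submod V W).
Proof.
move=> [VU nUV maxV].
have VWUW : {subset cap_submod V W <= cap_submod U W}.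
  by move=> x /andP[/VU xU xW]; rewrite cap_submodE xU.
have [UWVW|nUWVW] := EM {subset cap_submod U W <= cap_submod V W}.
  by left; exact: submod_eqP.
right; split=> // Y VWY YUW.
have YU x : x \in Y -> x \in U by move=> /YUW/andP[].
have YW x : x \in Y -> x \in W by move=> /YUW/andP[].
case: (maxV (add_submod Y V)) => [x|x|addV|addU].
- exact: add_submodr.
- exact: add_submod_sub.
- left; apply: submod_eqP => // y yY; rewrite cap_submodE YW // andbT -addV.
  exact: add_submodl.
right; apply: submod_eqP => // x /andP[]; rewrite -addU => /add_submodP[y [v [yY vV ->]]] yvW.
rewrite rpredD //; apply: VWY; rewrite cap_submodE vV.
have -> : v = (y + v) - y by rewrite addrC addKr.
by rewrite submodB // YW.
Qed.

(** A finite descending chain with simple factors whose length is not recorded: adding or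
    intersecting with a fixed submodule collapses an unknown number of steps of a series. *)
Inductive reaches : submodClosed M -> submodClosed M -> Prop :=
| reaches_refl U W : U =i W -> reaches U W
| reaches_step U V W : maximal_submod U V -> reaches V W -> reaches U W.

Lemma reaches_eql U U' W : U =i U' -> reaches U W -> reaches U' W.
Proof.
move=> UU' UW; case: UW UU' => {U W}[U W UW|U V W UV VW] UU'.
  by apply: reaches_refl => x; rewrite -UU'.
by apply: reaches_step VW; exact: maximal_submod_eql UV.
Qed.

Lemma reaches_sub U W : reaches U W -> {subset W <= U}.
Proof.
by elim=> {U W}[U W UW x|U V W [VU _ _] _ WV x /WV/VU//]; rewrite UW.
Qed.

Lemma reaches_inv U W : reaches U W ->
  U =i W \/ exists2 V, maximal_submod U V & reaches V W.
Proof. by case=> {U W} [U W UW|U V W UV VW]; [left|right; exists V]. Qed.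

Lemma length_reaches U n : has_length M n ->
  reaches (full_submod M) U /\ reaches U (zero_submod M).
Proof.
move=> [S [S0 Sn maxS]].
have {}maxS i : (i < n)%N -> maximal_submod (S i) (S i.+1) by exact: maxS.
split.
  suff: reaches (add_submod (S (n - n)%N) U) U.
    rewrite subnn; apply: reaches_eql => x; rewrite full_submodE.
    by apply: add_submodl; rewrite S0.
  (* Chains grow at the top, so the induction climbs the series from its bottom term [S n]. *)
  suff: forall k, (k <= n)%N -> reaches (add_submod (S (n - k)%N) U) U by apply.
  elim=> [_|k IHk kn].
    rewrite subn0; apply: reaches_refl; apply: submod_eqP; last exact: add_submodr.
    by apply: add_submod_sub => // x; rewrite Sn zero_submodE => /eqP->; exact: rpred0.
  have := IHk (ltnW kn); rewrite -(subnSK kn) => IH.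
  have /maxS : (n - k.+1 < n)%N by rewrite ltn_subrL (leq_trans _ kn).
  case/(maximal_submod_add U) => [eqS|]; last by move/reaches_step; apply.
  by apply: reaches_eql IH => x; rewrite eqS.
suff: reaches (cap_submod (S (n - n)%N) U) (zero_submod M).
  by rewrite subnn; apply: reaches_eql => x; rewrite cap_submodE S0.
suff: forall k, (k <= n)%N -> reaches (cap_submod (S (n - k)%N) U) (zero_submod M) by apply.
elim=> [_|k IHk kn].
  rewrite subn0; apply: reaches_refl; apply: submod_eq0 => x /andP[].
  by rewrite Sn zero_submodE => /eqP.
have := IHk (ltnW kn); rewrite -(subnSK kn) => IH.
have /maxS : (n - k.+1 < n)%N by rewrite ltn_subrL (leq_trans _ kn).
case/(maximal_submod_cap U) => [eqS|]; last by move/reaches_step; apply.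
by apply: reaches_eql IH => x; rewrite eqS.
Qed.

Lemma reaches_series U V n (S : nat -> submodClosed M) : reaches U V ->
  S 0%N =i V -> S n =i zero_submod M ->
  (forall i, (i < n)%N -> maximal_submod (S i) (S i.+1)) ->
  exists m (T : nat -> submodClosed M),
    [/\ T 0%N =i U, T m =i zero_submod M,
        forall i, (i < m)%N -> maximal_submod (T i) (T i.+1) &
        exists2 i, (i <= m)%N & T i =i V].
Proof.
move=> UV S0 Sn maxS; elim: UV S0 => {U V} [U V UV|U W V maxW _ IH] S0.
  by exists n, S; split=> // [x|]; [rewrite S0 UV|exists 0%N].
have [m [T [T0 Tm maxT [i im Ti]]]] := IH S0.
exists m.+1, (fun i => if i is i'.+1 then T i' else U); split=> //.
  case=> [_|j jm]; last exact: maxT.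
  case: maxW => WU nUW maxW; split=> [x|UT|Y TY YU]; first by rewrite T0; exact: WU.
    by apply: nUW => x /UT; rewrite T0.
  have [x xW|//|YW|YU'] := maxW Y; [by apply: TY; rewrite T0| |by right].
  by left=> x; rewrite YW T0.
by exists i.+1.
Qed.

Lemma reaches_has_length U : reaches U (zero_submod M) ->
  exists n (S : nat -> submodClosed M), [/\ S 0%N =i U, S n =i zero_submod M &
    forall i, (i < n)%N -> maximal_submod (S i) (S i.+1)].
Proof.
move=> U0; have [||//|m [T [T0 Tm maxT _]]] :=
  @reaches_series U (zero_submod M) 0 (fun=> zero_submod M) U0 => //.
by exists m, T.
Qed.

(** Every submodule occurs in some composition series, hence by uniqueness among the terms of the
    given one. *)
Lemma uniserial_total : uniserial M -> submod_total M.
Proof.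
move=> [n [S [cS uniqS]]]; have lenM : has_length M n by exists S.
have Sdec i j : (i <= j)%N -> (j <= n)%N -> {subset S j <= S i}.
  elim: j => [|j IHj]; first by rewrite leqn0 => /eqP-> _ x.
  rewrite leq_eqVlt => /predU1P[-> _ x //|ij jn x xS]; apply: (IHj ij (ltnW jn)).
  by have [_ _ /(_ _ jn)[]] := cS => sub _ _; exact: sub.
have SP U : exists2 i, (i <= n)%N & U =i S i.
  have [MU U0] := length_reaches U lenM.
  have [k [T [T0 Tk maxT]]] := reaches_has_length U0.
  have [m [T' [T'0 T'm maxT' [i im T'i]]]] := reaches_series MU T0 Tk maxT.
  have [] := uniqS m T'; first by split.
  by move=> mn eqT'; rewrite mn in im; exists i => // x; rewrite -T'i eqT'.
move=> U V; have [[i ni Ui] [j nj Vj]] := (SP U, SP V).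
have [ij|/ltnW ji] := leqP i j; [right|left] => x; rewrite Ui Vj; exact: Sdec.
Qed.

Lemma has_length_maximal n U : has_length M n -> ~ (forall x, x \in U) ->
  exists2 V, maximal_submod (full_submod M) V & {subset U <= V}.
Proof.
move=> lenM nU; have [MU _] := length_reaches U lenM.
case: (reaches_inv MU) => [FU|[V maxV /reaches_sub VU]]; last by exists V.
by case: nU => x; rewrite -FU.
Qed.

Lemma has_length_nonzero n U : has_length M n -> ~ U =i zero_submod M ->
  exists V, maximal_submod U V.
Proof.
move=> lenM nU; have [_] := length_reaches U lenM.
by case/reaches_inv=> [//|[V maxV _]]; exists V.
Qed.

End CompositionSeries.

(** * Radicals, and hollowness of factor serial modules *)

Section HollowModules.
Variable A : pzRingType.
Implicit Types M N P X : lmodType A.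

Lemma hollow_rad M (U : submodClosed M) :
  hollow M -> ~ (forall x, x \in U) -> {subset U <= radn M 1}.
Proof.
move=> hM nU x xU; apply/asboolP; split=> // V [_ nV maxV].
case: (maxV (add_submod U V)) => [y|y _|UV_V|UV_M].
- exact: add_submodr.
- exact: full_submodE.
- by rewrite -UV_V; exact: add_submodl.
case: (hM U V) => [y||V_M]; [by rewrite UV_M|by []|].
by case: nV => y _; exact: V_M.
Qed.

(** Nakayama's lemma: a proper [U] lies in a maximal submodule, which also contains the radical. *)
Lemma rad_superfluous M n (U : submodClosed M) : has_length M n ->
  (forall x, x \in add_submod U (radn M 1)) -> forall x, x \in U.
Proof.
move=> lenM UR; apply: contrapT => nU.
have [V maxV UV] := has_length_maximal lenM nU.
case: (maxV) => _ nV _; apply: nV => x _.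
by apply: (add_submod_sub UV _ (UR x)) => y /asboolP[_]; apply.
Qed.

Lemma rad_proper M n : nonzero M -> has_length M n -> ~ (forall x, x \in radn M 1).
Proof.
move=> [x /eqP x0] lenM radM; apply: x0; apply/eqP.
rewrite -zero_submodE; apply: (rad_superfluous lenM) => y.
by apply: add_submodr; exact: radM.
Qed.

Lemma radn_leq M m n : (m <= n)%N -> {subset radn M n <= radn M m}.
Proof.
elim: n => [|n IHn]; first by rewrite leqn0 => /eqP->.
by rewrite leq_eqVlt => /predU1P[-> x //|/IHn sub x /radn_subS/sub].
Qed.

Lemma two_factor_serial_hollow M : indecomposable M -> two_factor_serial M -> hollow M.
Proof.
move=> indM [_ [[|[|[|l]]] [lenM // _ uniq _]]]; last first.
  have rad_sub x : x \in radn M (l.+3 - 2) -> x \in radn M 1.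
    by apply: radn_leq; rewrite subSS subSS.
  have sup (U V : submodClosed M) :
      (forall x, x \in add_submod U V) ->
      {subset im_submod (quo_pi (radn M (l.+3 - 2))) U
        <= im_submod (quo_pi (radn M (l.+3 - 2))) V} ->
      forall x, x \in V.
    move=> UV imUV; apply: (rad_superfluous lenM) => x.
    have /add_submodP[u [v [uU vV ->]]] := UV x.
    have /imUV/im_submodP[v' v'V /quo_piP/rad_sub uv'] := im_submod_mem (quo_pi (radn M (l.+3 - 2))) uU.
    by apply/add_submodP; exists (v' + v), (u - v'); rewrite rpredD // addrAC subrKC.
  move=> U V UV; have [le|le] := uniserial_total uniq (im_submod (quo_pi _) U) (im_submod (quo_pi _) V).
    by right; exact: sup UV le.
  left; apply: sup le => x; have /add_submodP[u [v [uU vV ->]]] := UV x.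
  by apply/add_submodP; exists v, u; rewrite addrC.
have [S [S0 S2 maxS]] := lenM.
have [_ nS1 maxS1] : maximal_submod (S 0) (S 1) := maxS 0%N isT.
have [_ nS2 maxS2] : maximal_submod (S 1) (S 2) := maxS 1%N isT.
(* In length 2, a nonzero proper submodule outside [S 1] would be a direct complement of [S 1]. *)
have [[U [nU0 nU1 nUM]]|noU] := EM (exists U : submodClosed M,
  [/\ ~ (forall x, x \in U -> x = 0), ~ {subset U <= S 1%N} & ~ (forall x, x \in U)]).
  exfalso; have S0E x : x \in S 0%N by rewrite S0.
  have sumE x : x \in add_submod U (S 1%N).
    case: (maxS1 (add_submod U (S 1%N))) => [y|y _|addS1|->].
    - exact: add_submodr.
    - exact: S0E.
    - by case: nU1 => y yU; rewrite -addS1; exact: add_submodl.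
    - exact: S0E.
  have capE x : x \in U -> x \in S 1%N -> x = 0.
    move=> xU xS1; case: (maxS2 (cap_submod U (S 1%N))) => [y|y /andP[]//|cap2|cap1].
    - by rewrite S2 zero_submodE => /eqP->; exact: rpred0.
    - by apply/eqP; rewrite -zero_submodE -S2 -cap2 cap_submodE xU.
    - case: nUM => y; have /add_submodP[u [v [uU vS ->]]] := sumE y.
      by move: vS; rewrite -cap1 => /andP[vU _]; rewrite rpredD.
  have [U0|S10] := indecomposable_dsum indM sumE capE; first exact: nU0.
  by apply: nS2 => x /S10 ->; exact: rpred0.
have subS1 (U : submodClosed M) : ~ (forall x, x \in U) -> {subset U <= S 1%N}.
  move=> nUM; apply: contrapT => nU1; apply: noU; exists U; split=> // U0.
  by apply: nU1 => x /U0 ->; exact: rpred0.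
move=> U V UV; apply: contrapT => /not_orP[nU nV]; apply: nS1 => x _.
exact: (add_submod_sub (subS1 U nU) (subS1 V nV) (UV x)).
Qed.

Lemma factor_serial_hollow M : indecomposable M ->
  one_factor_serial M \/ two_factor_serial M -> hollow M.
Proof.
move=> indM [[_ /uniserial_total/total_hollow//]|]; exact: two_factor_serial_hollow.
Qed.

Lemma rad_submod_total M (U V : submodClosed M) :
  submod_total M -> maximal_submod U V -> rad_submod U =i V.
Proof.
move=> totM maxUV; have [VU nUV maxV] := maxUV.
apply: submod_eqP => [x /asboolP[_]|x xV]; first exact.
apply/asboolP; split=> [|W [WU nUW maxW]]; first exact: VU.
have [WV|VW] := totM W V; last exact: VW.
by have [<-|VU'] := maxW V WV VU; last by case: nUV => y; rewrite VU'.
Qed.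

Lemma uniserial_radn M n : uniserial M -> ~ radn M n =i zero_submod M ->
  maximal_submod (radn M n) (radn M n.+1).
Proof.
move=> uM nz; have [k [S [cS _]]] := uM; have lenM : has_length M k by exists S.
have [V maxV] := has_length_nonzero lenM nz.
have eqV := rad_submod_total (uniserial_total uM) maxV.
case: maxV => VU nUV maxV; split=> [|UR|W RW WU]; first exact: rad_submod_sub.
  by apply: nUV => x /UR; rewrite eqV.
have [x xV|//|WV|WU'] := maxV W; last by right.
  by apply: RW; rewrite eqV.
by left=> x; rewrite WV eqV.
Qed.

Lemma loewy_radn M t : (t < loewy_length M)%N -> ~ radn M t =i zero_submod M.
Proof.
(* The default value 0 contradicts [t < 0], so only a true minimum remains. *)
rewrite /loewy_length; case: pselect => // e; case: ex_minnP => m _ minm.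
by rewrite ltnNge => /negP lt0 rad0; apply: lt0; apply: minm; apply/asboolP.
Qed.

(* U is then generated by any element outside V. *)
Lemma fg_submod_type M (U V : submodClosed M) : ~ {subset U <= V} ->
  (forall W : submodClosed M, {subset W <= U} -> {subset W <= V} \/ {subset U <= W}) ->
  finitely_generated (submod_type U).
Proof.
move=> nUV UVP; have [x [xU nxV]] : exists x, x \in U /\ ~ x \in V.
  by apply: contrapT => nx; apply: nUV => x xU; apply: contrapT => nxV; apply: nx; exists x.
have [y yx] := submod_val_surj xU.
have [|g gE] := @linear_map A A^o (submod_type U) (fun a : A => a *: y).
  by move=> a b c; rewrite scalerDl scalerA.
apply: (fg_surj (g := g)); last first.
  exists 1%N, (fun=> 1) => a; exists (fun=> a).
  by rewrite big_ord1; rewrite /GRing.scale /= mulr1.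
pose W := im_submod (submod_val U) (im_submod g (full_submod _)).
have xW : x \in W.
  rewrite -yx; apply: im_submod_mem; apply/im_submodP; exists 1 => //.
  by rewrite gE scale1r.
case: (UVP W) => [_ /im_submodP[z _ ->]|WV|UW z]; first exact: submod_valP.
  by case: nxV; exact: WV.
have /UW/im_submodP[_ /im_submodP[a _ ->] /submod_val_inj ->] := submod_valP z.
by exists a.
Qed.

Lemma simple_fg M (S : submodClosed M) :
  simple_submod S -> finitely_generated (submod_type S).
Proof.
move=> [nS simS]; apply: (@fg_submod_type _ _ (zero_submod M)).
  by move=> S0; apply: nS; apply: submod_eq0 => x /S0; rewrite zero_submodE => /eqP.
by move=> W /simS[W0|WS]; [left|right] => x; rewrite ?W0 ?WS.
Qed.

Lemma simple_total M (S : submodClosed M) :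
  simple_submod S -> submod_total (submod_type S).
Proof.
move=> [nS simS] U V.
case: (simS (im_submod (submod_val S) U)) => [_ /im_submodP[x _ ->]|U0|US].
- exact: submod_valP.
- left=> x; rewrite -im_submod_val U0 zero_submodE => /eqP x0.
  have -> : x = 0 by apply: submod_val_inj; rewrite x0 raddf0.
  exact: rpred0.
- by right=> x _; rewrite -im_submod_val US; exact: submod_valP.
Qed.

End HollowModules.

(** * The three almost split sequences *)

Section AlmostSplit.
Variables (A : pzRingType)
  (dccA : forall X : lmodType A, finitely_generated X -> submod_dcc X)
  (hollowA : forall X : lmodType A,
     finitely_generated X -> indecomposable X -> hollow X).
Implicit Types M N P X E : lmodType A.

Lemma quo_epi_pi M (U V : submodClosed M) (UV : {subset U <= V}) x :
  quo_epi UV (quo_pi U x) = quo_pi V x.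
Proof. exact: quo_map_pi. Qed.

Lemma quo_incl_pi M (U V : submodClosed M) (x : submod_type U) :
  quo_incl U V (quo_pi (submod_in U V) x) = quo_pi V (submod_val U x).
Proof. exact: (quo_map_pi (f := submod_val U)). Qed.

Lemma quo_incl_inj M (U V : submodClosed M) : injective (quo_incl U V).
Proof.
apply: linear_inj => y; have [x <-] := quo_pi_surj y.
by rewrite quo_incl_pi => /quo_pi0 xV; apply/quo_pi0.
Qed.

(** The image of [f] is a direct summand of [N], with complement the kernel of the retraction. *)
Lemma split_mono_indecomposable M N (f : {linear M -> N}) :
  indecomposable N -> split_mono f ->
  (forall x : M, x = 0) \/ (forall y, exists x, f x = y).
Proof.
move=> indN [r rP].
have dsum y : y \in add_submod (im_submod f (full_submod M)) (preim_submod r (zero_submod M)).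
  apply/add_submodP; exists (f (r y)), (y - f (r y)); rewrite subrKC.
  by split=> //; rewrite ?im_submod_mem // preim_submodE zero_submodE raddfB /= rP subrr.
case: (indecomposable_dsum indN dsum) => [y /im_submodP[x _ ->]|f0|r0].
- by rewrite preim_submodE zero_submodE rP => /eqP ->; rewrite raddf0.
- by left=> x; rewrite -[LHS]rP (f0 (f x)) ?raddf0 ?im_submod_mem.
right=> y; exists (r y); apply/esym/subr0_eq/r0.
by rewrite preim_submodE zero_submodE raddfB /= rP subrr.
Qed.

(* A hollow module X mapping onto a quotient P/W of a projective P is itself a
   quotient P/U with U contained in W. *)
Lemma right_almost_split_quo P (W : submodClosed P) E (g : {linear E -> quo W}) :
  finitely_generated P -> projective P -> hollow P -> ~ (forall x, x \in W) ->
  ~ split_epi g ->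
  (forall X, finitely_generated X -> forall h : {linear X -> quo W},
     (forall x, h x \in im_submod (quo_pi W) (radn P 1)) ->
     exists k : {linear X -> E}, forall x, g (k x) = h x) ->
  (forall U : submodClosed P, {subset U <= W} -> ~ {subset W <= U} ->
     exists2 k : {linear P -> E}, (forall x, x \in U -> k x = 0) &
       forall x, g (k x) = quo_pi W x) ->
  right_almost_split g.
Proof.
move=> fgP projP hP nW nsg gRad gU; apply: right_almost_split_indec => // X fgX indX h nsh.
have hX := hollowA fgX indX.
(* If [h] is not onto, the preimage of its image in [P] is proper, hence inside the radical of the
   hollow module [P]. *)
have [h_surj|nh_surj] := EM (forall y, exists x, h x = y); last first.
  apply: gRad => // x; have [y yx] := quo_pi_surj (h x).
  rewrite -yx; apply: im_submod_mem.
  apply: (@hollow_rad _ _ (preim_submod (quo_pi W) (im_submod h (full_submod X)))) => //.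
    move=> h_all; apply: nh_surj => z; have [z' <-] := quo_pi_surj z.
    by have := h_all z'; rewrite preim_submodE => /im_submodP[x' _ ->]; exists x'.
  by rewrite preim_submodE /= yx im_submod_mem.
have [pi piP] := projP X (quo W) fgX (fg_quo W fgP) h (quo_pi W) h_surj.
(* X is the sum of the image of [pi] and the kernel of [h]; it is hollow, and the kernel is proper
   because [W] is. *)
have pi_surj x : exists y, pi y = x.
  case: (hX (im_submod pi (full_submod P)) (preim_submod h (zero_submod _))) => [y||h0].
  - have [z zy] := quo_pi_surj (h y).
    apply/add_submodP; exists (pi z), (y - pi z); rewrite subrKC im_submod_mem //.
    by split=> //; rewrite preim_submodE zero_submodE raddfB /= piP /= zy subrr.
  - by move=> /(_ x)/im_submodP[y _ ->]; exists y.
  - case: nW => y; apply/quo_pi0; have [z <-] := h_surj (quo_pi W y).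
    by have := h0 z; rewrite preim_submodE zero_submodE => /eqP.
pose U := preim_submod pi (zero_submod X).
have UP x : x \in U <-> pi x = 0.
  by rewrite preim_submodE zero_submodE; split=> /eqP.
have [|WU|k kU kP] := gU U.
- by move=> x /UP pix0; apply/quo_pi0; rewrite -piP pix0 raddf0.
(* If [U] contained [W], then [h] would be an isomorphism. *)
- apply: nsh; apply: bij_split_epi => //; apply: linear_inj => x.
  by have [y <-] := pi_surj x; rewrite piP => /quo_pi0/WU/UP.
have [x /UP/kU //|k' k'P] := @lin_desc _ _ _ _ pi k pi_surj.
by exists k' => x; have [y <-] := pi_surj x; rewrite k'P kP piP.
Qed.

(** Maps into rad(P)/U lift because the complement [V] maps isomorphically onto it; for a proper
    submodule of the simple [U], which is zero, the identity of [P] is a lift. *)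
Lemma almost_split_simple_summand P (U V : submodClosed P) :
  finitely_generated P -> projective P -> indecomposable P ->
  ~ (forall x, x \in radn P 1) ->
  simple_submod U -> internal_dsum (radn P 1) U V ->
  almost_split (submod_val U) (quo_pi U).
Proof.
move=> fgP projP indP nrad simU [UR VR UV UV0].
have hP := hollowA fgP indP.
have [nU simUP] := simU.
have fgU := simple_fg simU.
have locU : local_end (submod_type U).
  by apply: local_end_total; [exact: simple_total|exact: dccA].
have exactU : short_exact (submod_val U) (quo_pi U).
  split; [exact: submod_val_inj| |exact: quo_pi_surj].
  move=> y; split=> [/quo_pi0/submod_val_surj//|[x <-]].
  by apply/quo_pi0; exact: submod_valP.
have nUP : ~ forall x, x \in U by move=> UP; apply: nrad => x; exact: UR.
have nsg : ~ split_epi (quo_pi U).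
  move/(split_epi_mono exactU)/(split_mono_indecomposable indP) => [U0|U_surj].
    apply: nU; apply: submod_eq0 => _ /submod_val_surj[x <-].
    by rewrite (U0 x) raddf0.
  by apply: nUP => x; have [y <-] := U_surj x; exact: submod_valP.
have rsplit : right_almost_split (quo_pi U).
  apply: right_almost_split_quo => // [X fgX h hrad|W WU nUW].
    have [|x|k kP] := @lin_lift _ _ _ _ (quo_pi U \o submod_val V) h.
    - apply: linear_inj => x /quo_pi0 xU; apply: submod_val_inj; rewrite raddf0.
      by apply: UV0 => //; exact: submod_valP.
    - have /im_submodP[_ /UV[u [v [uU /submod_val_surj[v' <-] ->]]] ->] := hrad x.
      by exists v'; apply/quo_piP; rewrite opprD addrCA subrr addr0 submodN.
    by exists (submod_val V \o k).
  exists idfun => // x xW; have [W0|WU'] := simUP W WU.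
    by move: xW; rewrite W0 zero_submodE => /eqP.
  by case: nUW => y; rewrite WU'.
split; [by split=> //; exact: fg_quo|split=> //].
exact: left_almost_split_local rsplit.
Qed.

(* The projection U -> S1 extends to P, because the inclusion U -> P of the
   simple module U is left almost split. *)
Lemma extend_projection P (S1 S2 U : submodClosed P) :
  finitely_generated P -> projective P -> indecomposable P ->
  ~ (forall x, x \in radn P 1) ->
  simple_submod S1 -> internal_dsum (radn P 1) S1 S2 ->
  {subset U <= radn P 1} -> (forall x, x \in U -> x \in S2 -> x = 0) ->
  exists phi : {linear P -> P},
    forall x, x \in U -> phi x \in S1 /\ x - phi x \in S2.
Proof.
move=> fgP projP indP nrad [nS1 simS1] [S1R S2R S12 S12_0] UR US2.
have [U0|nU0] := EM (U =i zero_submod P).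
  exists \0 => x; rewrite U0 zero_submodE => /eqP ->.
  by rewrite raddf0 subr0 !rpred0.
pose s : {linear (submod_type S1 * submod_type S2)%type -> P} :=
  row_map (submod_val S1) (submod_val S2).
have [|x|r rP] := @lin_lift _ _ _ _ s (submod_val U).
- exact: dsum_val_inj.
- have [u [v [/submod_val_surj[u' <-] /submod_val_surj[v' <-] xE]]] := S12 _ (UR _ (submod_valP x)).
  by exists (u', v'); rewrite /= xE.
pose p1 : {linear submod_type U -> P} := submod_val S1 \o fst \o r.
have p1S1 x : p1 x \in S1 by exact: submod_valP.
have p1S2 x : submod_val U x - p1 x \in S2.
  by rewrite -rP /= /row_map addrC addKr; exact: submod_valP.
(* The kernel of the first projection on [U] lies in [S2], which meets [U] trivially; so [U] embeds
   into [S1] and is simple. *)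
have p1_inj : injective p1.
  apply: linear_inj => x p1x0; apply: submod_val_inj; rewrite raddf0.
  by apply: US2; [exact: submod_valP|rewrite -[X in X \in _]subr0 -p1x0].
have imU (W : submodClosed (submod_type U)) :
    im_submod p1 W =i zero_submod P \/ im_submod p1 W =i S1.
  by apply: simS1 => _ /im_submodP[x _ ->].
have simU : simple_submod U.
  split=> // W WU; case: (imU (preim_submod (submod_val U) W)) => imW; [left|right].
    apply: submod_eq0 => w wW; have [x xw] := submod_val_surj (WU w wW).
    have : p1 x \in im_submod p1 (preim_submod (submod_val U) W).
      by apply: im_submod_mem; rewrite preim_submodE /= xw.
    rewrite imW zero_submodE => /eqP p1x0; rewrite -xw.
    have -> : x = 0 by apply: p1_inj; rewrite p1x0 raddf0.
    exact: raddf0.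
  apply: submod_eqP => // w /submod_val_surj[x <-].
  have := p1S1 x; rewrite -imW => /im_submodP[y yW /p1_inj ->].
  by [].
have dsumU : internal_dsum (radn P 1) U S2.
  split=> // x /S12[u [v [uS1 vS2 ->]]].
  case: (imU (full_submod _)) => im1.
    case: nU0; apply: submod_eq0 => _ /submod_val_surj[y <-].
    have : p1 y \in im_submod p1 (full_submod _) by exact: im_submod_mem.
    rewrite im1 zero_submodE => /eqP p1y0.
    have -> : y = 0 by apply: p1_inj; rewrite p1y0 raddf0.
    exact: raddf0.
  move: uS1; rewrite -im1 => /im_submodP[y _ ->].
  (* The [S1]-component is [p1 y]; it is replaced by [y] itself, and the difference, lying in [S2],
     is absorbed into [v]. *)
  exists (submod_val U y), (v - (submod_val U y - p1 y)).
  split; [exact: submod_valP|by rewrite submodB|].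
  by rewrite opprB [RHS]addrCA subrKC addrC.
have [_ [_ [_ lsplit] _]] := almost_split_simple_summand fgP projP indP nrad simU dsumU.
have [|phi phiP] := lsplit P fgP p1.
  (* [p1] does not split: [U] is nonzero, and the image lies in [S1], inside the proper radical. *)
  move/(split_mono_indecomposable indP) => [U0|p1_surj].
    by apply: nU0; apply: submod_eq0 => _ /submod_val_surj[x <-]; rewrite (U0 x) raddf0.
  by apply: nrad => x; have [y <-] := p1_surj x; exact: S1R.
by exists phi => _ /submod_val_surj[x <-]; rewrite phiP.
Qed.

Lemma almost_split_top P (S1 S2 : submodClosed P)
    (radE : internal_dsum (radn P 1) S1 S2) :
  finitely_generated P -> projective P -> indecomposable P ->
  ~ (forall x, x \in radn P 1) ->
  simple_submod S1 -> simple_submod S2 ->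
  almost_split (col_map (quo_pi S1) (quo_pi S2))
    (row_map (\- quo_epi (internal_dsum_subl radE)) (quo_epi (internal_dsum_subr radE))).
Proof.
move=> fgP projP indP nrad sim1 sim2; have [S1R S2R S12 S12_0] := radE.
have hP := hollowA fgP indP.

set f := (X in almost_split X _); set g := (X in almost_split _ X).
have locP := local_end_projective fgP projP hP indP.
have gE x y : g (quo_pi S1 x, quo_pi S2 y) = quo_pi (radn P 1) (y - x).
  by rewrite /g /= /row_map /= !quo_epi_pi addrC raddfB.
have fg_exact : short_exact f g.
  split.
  - by apply: linear_inj => x [/quo_pi0 xS1 /quo_pi0 xS2]; exact: S12_0.
  - case=> y1 y2; have [x1 <-] := quo_pi_surj y1; have [x2 <-] := quo_pi_surj y2.
    rewrite gE; split=> [/quo_pi0/S12[u [v [uS1 vS2 yxE]]]|[x [/quo_piP x1P /quo_piP x2P]]].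
      have x2E : x2 = x1 + u + v by rewrite -addrA -yxE subrKC.
      exists (x1 + u); congr pair; apply/quo_piP; first by rewrite addrC addKr.
      by rewrite x2E opprD addrA subrr add0r submodN.
    apply/quo_pi0; have -> : x2 - x1 = (x - x1) - (x - x2).
      by rewrite opprB [RHS]addrC subrKA.
    by apply: submodB; [exact: S1R|exact: S2R].
  - move=> z; have [x <-] := quo_pi_surj z.
    by exists (quo_pi S1 0, quo_pi S2 x); rewrite gE subr0.
have not_mono (S : submodClosed P) : simple_submod S -> ~ split_mono (quo_pi S).
  move=> [nS _] /split_mono_inj pi_inj; apply: nS; apply: submod_eq0 => x xS.
  by apply: pi_inj; rewrite raddf0; apply/quo_pi0.
have nsg : ~ split_epi g.
  by move/(split_epi_mono fg_exact)/(split_mono_col locP) => [/not_mono|/not_mono]; apply.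
have fgE : finitely_generated (quo S1 * quo S2)%type by apply: fg_prod; exact: fg_quo.
have rsplit : right_almost_split g.
  apply: right_almost_split_quo => // [X fgX h h0|U UR nRU].
    exists \0 => x; have /im_submodP[y yR ->] := h0 x.
    by rewrite raddf0; apply/esym/quo_pi0.
  suff [phi phiP] : exists phi : {linear P -> P},
      forall x, x \in U -> phi x \in S1 /\ x - phi x \in S2.
    exists (col_map (quo_pi S1 \o (\- phi)) (quo_pi S2 \o (idfun \- phi))) => x.
      move=> /phiP[phi1 phi2]; rewrite /= /col_map; congr pair; apply/quo_pi0 => //.
      exact: submodN.
    by rewrite /= gE opprK subrK.
  (* As [S1] and [S2] are simple and [U] does not contain the radical, [U] meets one of them
     trivially. If that is [S1], the roles are exchanged and [phi] is 1 - [psi]. *)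
  have [US2|nUS2] := EM (forall x, x \in U -> x \in S2 -> x = 0).
    exact: (extend_projection fgP projP indP nrad sim1 radE UR US2).
  have meet (S : submodClosed P) : simple_submod S ->
      ~ (forall x, x \in U -> x \in S -> x = 0) -> {subset S <= U}.
    move=> [_ simS] nUS; case: (simS (cap_submod U S)) => [x /andP[]//|cap0|capS].
      case: nUS => x xU xS; apply/eqP.
      by rewrite -zero_submodE -cap0 cap_submodE xU.
    by move=> x; rewrite -capS => /andP[].
  have US1 : forall x, x \in U -> x \in S1 -> x = 0.
    apply: contrapT => nUS1; apply: nRU => y /S12[u [v [uS1 vS2 ->]]].
    by apply: rpredD; [exact: (meet S1 sim1 nUS1)|exact: (meet S2 sim2 nUS2)].
  have [psi psiP] := extend_projection fgP projP indP nrad sim2 (internal_dsumC radE) UR US1.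
  exists (idfun \- psi) => x /psiP[psi2 psi1]; split=> //=.
  by rewrite opprB subrKC.
split; [by split=> //; exact: fg_quo|split=> //].
exact: left_almost_split_local rsplit.
Qed.

Lemma almost_split_uniserial P (t : nat) :
  finitely_generated P -> projective P -> uniserial P ->
  (1 <= t)%N -> (t < loewy_length P)%N ->
  almost_split
    (col_map (quo_epi (submod_in_mono (U := radn P 1) (radn_subS (n := t))))
       (quo_incl (radn P 1) (radn P t.+1)))
    (row_map (\- quo_incl (radn P 1) (radn P t)) (quo_epi (radn_subS (n := t)))).
Proof.
move=> fgP projP uniP t1 tP;
set f := (X in almost_split X _); set g := (X in almost_split _ X).
have totP := uniserial_total uniP; have hP := total_hollow totP.
have [_ nRt maxRt] := uniserial_radn uniP (loewy_radn tP).
have R1 x : x \in radn P t -> x \in radn P 1 by exact: radn_leq.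
have nz1 : ~ radn P 1 =i zero_submod P.
  move=> R0; apply: nRt => x /R1; rewrite R0 zero_submodE => /eqP->; exact: rpred0.
have nzP : nonzero P.
  apply: contrapT => P0; apply: nRt => x _.
  have -> : x = 0 by apply: contrapT => /eqP x0; apply: P0; exists x.
  exact: rpred0.
have [n [S [cS _]]] := uniP; have lenP : has_length P n by exists S.
have nrad := rad_proper nzP lenP.
(* A proper submodule of rad(P) lies in rad^2(P), so one element outside rad^2(P) generates. *)
have fgR1 : finitely_generated (submod_type (radn P 1)).
  have [_ nR2 maxR2] := uniserial_radn uniP nz1.
  apply: (fg_submod_type nR2) => W WR1; have [|R2W] := totP W (radn P 2); first by left.
  by have [//|//|WR2|WR1'] := maxR2 W; [left|right] => x; rewrite ?WR2 ?WR1'.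
have fgK : finitely_generated (quo (submod_in (radn P 1) (radn P t.+1))) by exact: fg_quo.
have locK : local_end (quo (submod_in (radn P 1) (radn P t.+1))).
  by apply: local_end_total; [exact/total_quo/total_submod|exact: dccA].
have fE x : f (quo_pi _ x) = (quo_pi _ x, quo_pi _ (submod_val _ x)).
  by rewrite /f /= /col_map quo_epi_pi quo_incl_pi.
have gE x y : g (quo_pi _ x, quo_pi _ y) = quo_pi (radn P t) (y - submod_val _ x).
  by rewrite /g /= /row_map /= quo_epi_pi quo_incl_pi addrC raddfB.
have fg_exact : short_exact f g.
  split.
  - by move=> x y [_ /quo_incl_inj].
  - case=> y1 y2; have [x1 <-] := quo_pi_surj y1; have [x2 <-] := quo_pi_surj y2.
    rewrite gE; split=> [/quo_pi0 x12|[y]].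
      have /submod_val_surj[x xE] : x2 \in radn P 1.
        rewrite -(subrK (submod_val _ x1) x2).
        by apply: rpredD; [exact: R1|exact: submod_valP].
      exists (quo_pi _ x); rewrite fE xE; congr pair; apply/quo_piP.
      by rewrite -xE -raddfB in x12.
    have [x <-] := quo_pi_surj y; rewrite fE => -[/quo_piP x1E /quo_piP x2E].
    apply/quo_pi0; have -> : x2 - submod_val _ x1 = submod_val _ (x - x1) - (submod_val _ x - x2).
      by rewrite raddfB opprB [RHS]addrC subrKA.
    by rewrite submodB // ; apply: radn_subS.
  - move=> z; have [x <-] := quo_pi_surj z.
    by exists (quo_pi _ 0, quo_pi _ x); rewrite gE (raddf0 (submod_val _)) subr0.
have fgE : finitely_generated
    (quo (submod_in (radn P 1) (radn P t)) * quo (radn P t.+1))%type.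
  by apply: fg_prod; exact: fg_quo.
have nsg : ~ split_epi g.
  (* [q] is not injective, its kernel being the nonzero rad^t/rad^(t+1). [i] does not split: its
     target is indecomposable, its source nonzero, and its image proper. *)
  move/(split_epi_mono fg_exact)/(split_mono_col locK) => [/split_mono_inj q_inj|].
    apply: nRt => x xR; have [y yx] := submod_val_surj (R1 x xR).
    have /quo_pi0 : quo_pi (submod_in (radn P 1) (radn P t.+1)) y = 0.
      apply: q_inj; rewrite quo_epi_pi raddf0; apply/quo_pi0.
      by rewrite -yx in xR.
    by rewrite -yx.
  have nzQ : nonzero (quo (radn P t.+1)).
    apply: contrapT => Q0; apply: nrad => x; apply: (@radn_leq _ _ 1 t.+1) => //.
    by apply/quo_pi0; apply: contrapT => /eqP x0; apply: Q0; exists (quo_pi _ x).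
  have indQ := hollow_indecomposable (total_hollow (total_quo (U := radn P t.+1) totP)) nzQ.
  move=> /(split_mono_indecomposable indQ)[K0|i_surj].
    apply: nRt => x xR; have [y yx] := submod_val_surj (R1 x xR).
    by have /quo_pi0 := K0 (quo_pi (submod_in (radn P 1) (radn P t.+1)) y); rewrite -yx.
  apply: nrad => x; have [y yx] := i_surj (quo_pi _ x).
  move: yx; have [z <-] := quo_pi_surj y; rewrite quo_incl_pi => /esym/quo_piP xz.
  rewrite -(subrK (submod_val _ z) x) rpredD ?submod_valP //.
  exact: (@radn_leq _ _ 1 t.+1).
have rsplit : right_almost_split g.
  apply: right_almost_split_quo => // [Rt|X fgX h hR1|U URt nRtU].
  - by apply: nrad => x; exact/R1/Rt.
  - have [x|k kP] := @lin_lift _ _ _ _ (quo_incl (radn P 1) (radn P t)) h (@quo_incl_inj _ _ _).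
      have /im_submodP[_ /submod_val_surj[z <-] ->] := hR1 x.
      by exists (quo_pi _ z); rewrite quo_incl_pi.
    (* The sign compensates for the entry [-j] of the row. *)
    exists (col_map (\- k) \0) => x.
    by rewrite /= /g /row_map /= raddf0 addr0 linearN opprK kP.
  (* A proper submodule of rad^t lies in rad^(t+1), so the canonical map to P/rad^(t+1) kills
     [U]. *)
  exists (col_map \0 (quo_pi (radn P t.+1))) => x; last first.
    by rewrite /= /g /row_map /= raddf0 oppr0 add0r quo_epi_pi.
  move=> xU; rewrite /= /col_map; congr pair; apply/quo_pi0.
  have [|RU] := totP U (radn P t.+1); first exact.
  have [//|//|<-//|URt'] := maxRt U.
  by case: nRtU => y; rewrite URt'.
split; [by split=> //; exact: fg_quo|split=> //].
exact: left_almost_split_local rsplit.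
Qed.

End AlmostSplit.

Theorem theorem5p10 (R : comPzRingType) (L : algType R)
    (artinL : artin_algebra L) (nakL : right_2Nakayama L)
    (M : lmodType L^c) (fgM : finitely_generated M)
    (indM : indecomposable M) (nprojM : ~ projective M) :
  [/\ forall (P : lmodType L^c) (t : nat),
        finitely_generated P -> projective P -> uniserial P ->
        (1 <= t)%N -> (t < loewy_length P)%N ->
        isomorphic M (quo (radn P t)) ->
        let q : {linear quo (submod_in (radn P 1) (radn P t.+1)) ->
                        quo (submod_in (radn P 1) (radn P t))} :=
          quo_epi (submod_in_mono (radn_subS (n := t))) in
        let i : {linear quo (submod_in (radn P 1) (radn P t.+1)) ->
                        quo (radn P t.+1)} :=
          quo_incl (radn P 1) (radn P t.+1) in
        let j : {linear quo (submod_in (radn P 1) (radn P t)) ->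
                        quo (radn P t)} :=
          quo_incl (radn P 1) (radn P t) in
        let p : {linear quo (radn P t.+1) -> quo (radn P t)} :=
          quo_epi (radn_subS (n := t)) in
        almost_split (col_map q i) (row_map (\- j) p),
      forall (P : lmodType L^c) (S : nat -> submodClosed P) (t : nat),
        finitely_generated P -> projective P -> indecomposable P ->
        two_factor_serial P ->
        simple_submod (S 1%N) -> simple_submod (S 2%N) ->
        radn P 1 =i soc P -> internal_dsum (radn P 1) (S 1%N) (S 2%N) ->
        (1 <= t <= 2)%N ->
        isomorphic M (quo (S t)) ->
        almost_split (submod_val (S t)) (quo_pi (S t))
    & forall (P : lmodType L^c) (S1 S2 : submodClosed P),
        finitely_generated P -> projective P -> indecomposable P ->
        two_factor_serial P ->
        simple_submod S1 -> simple_submod S2 ->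
        radn P 1 =i soc P ->
        forall radE : internal_dsum (radn P 1) S1 S2,
        isomorphic M (quo (radn P 1)) ->
        let pi1 : {linear P -> quo S1} := quo_pi S1 in
        let pi2 : {linear P -> quo S2} := quo_pi S2 in
        let pi3 : {linear quo S1 -> quo (radn P 1)} :=
          quo_epi (internal_dsum_subl radE) in
        let pi4 : {linear quo S2 -> quo (radn P 1)} :=
          quo_epi (internal_dsum_subr radE) in
        almost_split (col_map pi1 pi2) (row_map (\- pi3) pi4)].
Proof.
have dccL X := @artin_algebra_dcc R L X artinL.
have hollowL (X : lmodType L^c) : finitely_generated X -> indecomposable X -> hollow X.
  by move=> fgX indX; apply: factor_serial_hollow (nakL.1 X fgX indX).
split=> [P t fgP projP uniP t1 tP _|P S t fgP projP indP tfP sim1 sim2 _ radE t12 _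
        |P S1 S2 fgP projP indP tfP sim1 sim2 _ radE _].
- exact: almost_split_uniserial.
- have [n [lenP _ _ _]] := tfP.2; have nrad := rad_proper tfP.1 lenP.
  case: t t12 => [|[|[|t]]] // _.
    exact: almost_split_simple_summand radE.
  exact: almost_split_simple_summand (internal_dsumC radE).
- have [n [lenP _ _ _]] := tfP.2.
  by apply: almost_split_top => //; exact: rad_proper tfP.1 lenP.
Qed.
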